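(* For $n\geq 1$ and $p\geq 0$ let $T_n^{(p)}$ be the number of rooted planar triangulations with a boundary of length $p$ and $n$ vertices in total, and let $$\mathbf{T}(x,y)=\sum_{n\geq 1,\,p\geq 0}T_n^{(p)}x^n y^p,\qquad \mathbf{T}^{\bullet}=x\,\partial_x\mathbf{T},\qquad \mathfrak{T}(x)=[y^1]\mathbf{T}(x,y),\qquad \mathfrak{T}^{\bullet}(x)=x\,\mathfrak{T}'(x).$$ Then, as formal power series, $$6\mathbf{T}^{\bullet}-2y\,\partial_y\mathbf{T}-6\mathbf{T}+y\,\partial_y(y\mathbf{T})=\frac{4y}{x}\,\mathbf{T}^{\bullet}\left(\frac{\mathfrak{T}^{\bullet}-\mathfrak{T}}{1-\mathfrak{T}^{\bullet}/x}\right)+y\left(4\mathbf{T}^{\bullet}-3\mathbf{T}-y\,\partial_y\mathbf{T}\right).$$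
   Context: A planar map is a finite connected graph (loops and multiple edges allowed) properly embedded in the two-dimensional sphere, considered up to continuous (orientation-preserving) deformation. It is rooted if an oriented edge is distinguished. The degree of a face is the number of edges incident to it, i.e. the number of sides of its underlying polygon (an edge with the same face on both sides is counted twice). A rooted triangulation with a boundary of length $p$ ($p\geq 1$) is a rooted planar map in which the face lying to the right of the root edge (the external face, or boundary) has degree $p$ and all other faces have degree $3$; the boundary is not required to be simple. By convention, the map consisting of a single vertex and no edge is the unique triangulation with a boundary of length $0$, so $T_1^{(0)}=1$ and $T_n^{(0)}=0$ for $n\geq 2$. One has $\mathfrak{T}(x)=x^2+4x^3+32x^4+336x^5+\cdots$ (this is also the generating function, by number of vertices, of rooted triangulations without boundary, the single-edge map with two vertices being counted as a triangulation), so $1-\mathfrak{T}^{\bullet}/x$ is invertible as a power series. Here $[y^1]\mathbf{T}$ denotes the coefficient of $y^1$ in $\mathbf{T}$, a power series in $x$. *)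

(* Defs.v *)
From HB Require Import structures.
From mathcomp Require Import all_boot all_order all_fingroup all_algebra.
From mathcomp Require Import boolp zify.

Set Implicit Arguments.
Unset Strict Implicit.
Unset Printing Implicit Defensive.

Import GRing.Theory.

(** * Formal power series *)

Record fps (R : Type) := Fps { fps_coef :> nat -> R }.
Arguments fps_coef {R} f n%_nat_scope.

Local Open Scope ring_scope.

Lemma fpsP (R : Type) (f g : fps R) : f =1 g -> f = g.
Proof. by case: f g => [f] [g] /= /funext ->. Qed.

HB.instance Definition _ (R : Type) := gen_eqMixin (fps R).
HB.instance Definition _ (R : Type) := gen_choiceMixin (fps R).

Section FpsZmodule.
Variable R : zmodType.
Implicit Types f g h : fps R.

Definition fps_zero : fps R := Fps (fun=> 0).
Definition fps_add f g : fps R := Fps (fun n => f n + g n).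
Definition fps_opp f : fps R := Fps (fun n => - f n).

Fact fps_addA : associative fps_add.
Proof. by move=> f g h; apply: fpsP => n /=; rewrite addrA. Qed.
Fact fps_addC : commutative fps_add.
Proof. by move=> f g; apply: fpsP => n /=; rewrite addrC. Qed.
Fact fps_add0 : left_id fps_zero fps_add.
Proof. by move=> f; apply: fpsP => n /=; rewrite add0r. Qed.
Fact fps_addN : left_inverse fps_zero fps_opp fps_add.
Proof. by move=> f; apply: fpsP => n /=; rewrite addNr. Qed.

HB.instance Definition _ := GRing.isZmodule.Build (fps R)
  fps_addA fps_addC fps_add0 fps_addN.

Lemma coef_fps0 n : (0 : fps R) n = 0. Proof. by []. Qed.
Lemma coef_fpsD f g n : (f + g) n = f n + g n. Proof. by []. Qed.
Lemma coef_fpsN f n : (- f) n = - f n. Proof. by []. Qed.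
Lemma coef_fpsB f g n : (f - g) n = f n - g n. Proof. by []. Qed.

End FpsZmodule.

Section FpsRing.
Variable R : comNzRingType.
Implicit Types f g h : fps R.

Definition fps_const (c : R) : fps R := Fps (fun n => if n == 0%N then c else 0).
Definition fps_X : fps R := Fps (fun n => (n == 1%N)%:R).
Definition fps_mul f g : fps R :=
  Fps (fun n => \sum_(i < n.+1) f i * g (n - i)%N).

Let trunc n f : {poly R} := \poly_(i < n) f i.

Fact coef_trunc_mul n f g i :
  (i < n)%N -> (trunc n f * trunc n g)`_i = fps_mul f g i.
Proof.
move=> lt_in; rewrite coefM; apply: eq_bigr => j _; rewrite !coef_poly.
by rewrite (leq_ltn_trans _ lt_in) ?(leq_ltn_trans _ lt_in) ?leq_subr ?leq_ord.
Qed.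

Fact fps_mulC : commutative fps_mul.
Proof.
move=> f g; apply: fpsP => n.
by rewrite -!(@coef_trunc_mul n.+1) // mulrC.
Qed.

Fact fps_mulA : associative fps_mul.
Proof.
move=> f g h; apply: fpsP => n.
have E a b c : fps_mul (fps_mul a b) c n
    = (trunc n.+1 a * trunc n.+1 b * trunc n.+1 c)`_n.
  rewrite coefM; apply: eq_bigr => i _.
  by rewrite coef_trunc_mul ?ltn_ord // coef_poly ltnS leq_subr.
by rewrite fps_mulC !E (mulrC (_ * _)) mulrA.
Qed.

Fact fps_mul1 : left_id (fps_const 1) fps_mul.
Proof.
move=> f; apply: fpsP => n /=; rewrite big_ord_recl /= mul1r subn0 big1 ?addr0 //.
by move=> i _; rewrite mul0r.
Qed.

Fact fps_mulDl : left_distributive fps_mul +%R.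
Proof.
move=> f g h; apply: fpsP => n /=; rewrite -big_split /=.
by apply: eq_bigr => i _; rewrite mulrDl.
Qed.

Fact fps_oner_neq0 : fps_const 1 != 0.
Proof. by apply/eqP => /(congr1 (fun f : fps R => f 0%N)) /eqP; rewrite oner_eq0. Qed.

HB.instance Definition _ := GRing.Zmodule_isComNzRing.Build (fps R)
  fps_mulA fps_mulC fps_mul1 fps_mulDl fps_oner_neq0.

Lemma coef_fps1 n : (1 : fps R) n = (n == 0%N)%:R.
Proof. by rewrite /GRing.one /=; case: eqP. Qed.

Lemma coef_fpsM f g n : (f * g) n = \sum_(i < n.+1) f i * g (n - i)%N.
Proof. by []. Qed.

(** Inversion: [f^-1] is the multiplicative inverse of [f] when there is one,
    and [f] itself otherwise; see [unit_fps] below. *)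
Definition fps_unit : {pred fps R} := [pred f : fps R | `[< exists g, g * f = 1 >]].
Definition fps_inv f : fps R :=
  if pselect (exists g, g * f = 1) is left ex_g then sval (cid ex_g) else f.

Fact fps_mulVx : {in fps_unit, left_inverse 1 fps_inv *%R}.
Proof.
by move=> f /asboolP ex_g; rewrite /fps_inv; case: pselect => // e; case: cid.
Qed.
Fact fps_unitPl f g : g * f = 1 -> fps_unit f.
Proof. by move=> gf1; apply/asboolP; exists g. Qed.
Fact fps_invr_out : {in [predC fps_unit], fps_inv =1 id}.
Proof. by move=> f /asboolPn nfU; rewrite /fps_inv; case: pselect. Qed.

HB.instance Definition _ := GRing.ComNzRing_hasMulInverse.Build (fps R)
  fps_mulVx fps_unitPl fps_invr_out.

(** The Euler operator [x d/dx]. *)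
Definition fps_theta f : fps R := Fps (fun n => f n *+ n).

(** Division by [x] of a series without constant coefficient. *)
Definition fps_divX f : fps R := Fps (fun n => f n.+1).

Lemma fps_divXK f : f 0%N = 0 -> fps_X * fps_divX f = f.
Proof.
move=> f0; apply: fpsP => -[|n]; rewrite coef_fpsM big_ord_recl /= mul0r add0r.
  by rewrite big_ord0 f0.
by rewrite big_ord_recl /= mul1r subn1 big1 ?addr0 // => i _; rewrite mul0r.
Qed.

End FpsRing.

Arguments fps_X {R}.

(** Coefficientwise image, used to let operations on series in [x] act on
    [fps (fps R)], the series in [y] whose coefficients are series in [x]. *)
Definition fps_map (R S : Type) (h : R -> S) (f : fps R) : fps S :=
  Fps (fun n => h (f n)).

Section FpsUnit.
Variables (R : comUnitRingType) (f : fps R).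

Fixpoint fps_inv_seq n : seq R :=
  if n is m.+1 then
    let s := fps_inv_seq m in
    rcons s (- ((f 0%N)^-1 * \sum_(i < m) f i.+1 * s`_(m - i.+1)) +
             (m == 0%N)%:R * (f 0%N)^-1)
  else [::].

Lemma size_fps_inv_seq n : size (fps_inv_seq n) = n.
Proof. by elim: n => //= n IHn; rewrite size_rcons IHn. Qed.

Lemma nth_fps_inv_seq n i : (i < n)%N ->
  (fps_inv_seq n)`_i = (fps_inv_seq i.+1)`_i.
Proof.
elim: n => // n IHn; rewrite ltnS leq_eqVlt => /predU1P[-> //|lt_in].
by rewrite -IHn // [fps_inv_seq n.+1]/= nth_rcons size_fps_inv_seq lt_in.
Qed.

Lemma unit_fps : (f \is a GRing.unit) = (f 0%N \is a GRing.unit).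
Proof.
apply/idP/idP => [fU | f0U].
  have /(congr1 (fun g : fps R => g 0%N)) := divrr fU.
  rewrite coef_fps1 coef_fpsM big_ord_recl big_ord0 addr0 => f0V.
  by apply/unitrPr; exists (f^-1 0%N).
apply/unitrPr; exists (Fps (fun n => (fps_inv_seq n.+1)`_n)).
apply: fpsP => n; rewrite coef_fpsM coef_fps1 big_ord_recl /= subn0.
rewrite nth_rcons size_fps_inv_seq ltnn eqxx mulrDr mulrN mulVKr //.
rewrite mulrCA divrr // mulr1 addrAC (_ : - _ + _ = 0) ?add0r // addrC.
apply/eqP; rewrite subr_eq0; apply/eqP/eq_bigr => i _; congr (_ * _).
by rewrite (@nth_fps_inv_seq n) // ltn_subrL; case: n i => [[]|].
Qed.

End FpsUnit.

(** * Rooted planar maps *)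

(** A rooted map is encoded by its half-edges ("darts"), each dart being seen as
    an edge oriented away from the vertex it is attached to.  [alpha] reverses
    darts, [sigma] rotates counterclockwise around the origin of a dart, and
    [root] is the root edge with its orientation.  Edges, vertices and faces are
    the cycles of [alpha], [sigma] and [phi], where [phi d = sigma (alpha d)] is
    the dart that follows [d] along the face on its right. *)
Definition rooted_map (D : finType) : Type := ({perm D} * {perm D} * D)%type.
HB.instance Definition _ (D : finType) := Finite.on (rooted_map D).

Section RootedMaps.
Variable D : finType.
Implicit Type M : rooted_map D.

Definition alpha M : {perm D} := M.1.1.
Definition sigma M : {perm D} := M.1.2.
Definition phi M : {perm D} := (alpha M * sigma M)%g.
Definition root M : D := M.2.

Definition edges M : {set {set D}} := porbits (alpha M).
Definition vertices M : {set {set D}} := porbits (sigma M).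
Definition faces M : {set {set D}} := porbits (phi M).
Definition external_face M : {set D} := porbit (phi M) (root M).

(** The last condition is Euler's formula for the sphere. *)
Definition planar_map M : bool :=
  [&& [forall d, alpha M d != d], [forall d, alpha M (alpha M d) == d],
      [transitive <<[set alpha M; sigma M]>>%g, on [set: D] | 'P]
    & #|vertices M| + #|faces M| == #|edges M| + 2]%N.

Definition triangulation_with_boundary (p : nat) M : bool :=
  [&& planar_map M, #|external_face M| == p
    & [forall F in faces M, (F != external_face M) ==> (#|F| == 3)%N]].

Definition map_iso : rel (rooted_map D) := fun M N =>
  [exists g : {perm D},
    [&& [forall d, g (alpha M d) == alpha N (g d)],
        [forall d, g (sigma M d) == sigma N (g d)]
      & g (root M) == root N]].

Lemma map_iso_equiv : equivalence_rel map_iso.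
Proof.
have isoP M N : reflect (exists g : {perm D},
    [/\ g \o alpha M =1 alpha N \o g, g \o sigma M =1 sigma N \o g
      & g (root M) = root N]) (map_iso M N).
  apply: (iffP existsP) => -[g].
    by case/and3P=> /forallP ga /forallP gs /eqP gr; exists g; split=> // d /=; apply/eqP.
  by case=> ga gs gr; exists g; rewrite gr eqxx andbT;
    apply/andP; split; apply/forallP => d; apply/eqP; [apply: ga | apply: gs].
have symm M N : map_iso M N -> map_iso N M.
  case/isoP=> g [ga gs gr]; apply/isoP; exists g^-1%g; split; last by rewrite -gr permK.
    by move=> d /=; apply: (canLR (permK g)); have /= -> := ga (g^-1%g d); rewrite permKV.
  by move=> d /=; apply: (canLR (permK g)); have /= -> := gs (g^-1%g d); rewrite permKV.
have trans M N P : map_iso M N -> map_iso N P -> map_iso M P.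
  case/isoP=> g [ga gs gr] /isoP[h [ha hs hr]]; apply/isoP; exists (g * h)%g.
  split=> [d|d|]; rewrite /= !permM.
  - by have /= -> := ga d; apply: ha.
  - by have /= -> := gs d; apply: hs.
  by rewrite gr hr.
apply/equivalence_relP; split=> [M|M N MN].
  by apply/isoP; exists 1%g; split=> [d|d|] /=; rewrite !perm1.
by move=> P; apply/idP/idP; [apply: trans; apply: symm | apply: trans].
Qed.

Let partition_porbits (s : {perm D}) : partition (porbits s) [set: D].
Proof.
suff -> : porbits s = preim_partition (porbit s) [set: D] by apply: preim_partitionP.
have E x : porbit s x = [set y in [set: D] | porbit s x == porbit s y].
  by apply/setP => y; rewrite !inE eq_porbit_mem porbit_sym.
by apply/setP => A; apply/imsetP/imsetP => -[x _ ->]; exists x; rewrite // -E.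
Qed.

Lemma card_darts p M : triangulation_with_boundary p M ->
  (#|D| + 2 * p + 6 = 6 * #|vertices M|)%N.
Proof.
case/and3P=> /and4P[/forallP a1 /forallP a2 _ /eqP euler] /eqP extp /forall_inP tri.
have E : (#|D| = #|edges M| * 2)%N.
  rewrite -cardsT; apply: card_uniform_partition.
    move=> _ /imsetP[d _ ->].
    have -> : porbit (alpha M) d = [set d; alpha M d].
      apply/setP => e; rewrite !inE; apply/porbitP/orP => [[i ->]|[]/eqP->].
      - elim: i => [|i]; first by rewrite expg0 perm1; left.
        by rewrite expgSr permM => -[]/eqP->; [right | left; apply: a2].
      - by exists 0%N; rewrite expg0 perm1.
      by exists 1%N; rewrite expg1.
    by rewrite cards2 eq_sym a1.
  exact: partition_porbits.
have Fx : external_face M \in faces M by apply: imset_f.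
have F : (#|D| = p + 3 * (#|faces M| - 1))%N.
  rewrite -cardsT (card_partition (partition_porbits (phi M))) (big_setD1 _ Fx) /=.
  rewrite extp (eq_bigr (fun=> 3)) => [|A]; last first.
    by rewrite in_setD1 => /andP[nx FA]; apply/eqP/(implyP (tri A FA)).
  by rewrite sum_nat_const (cardsD1 (external_face M) (faces M)) Fx add1n subn1 mulnC.
have: (0 < #|faces M|)%N by apply/card_gt0P; exists (external_face M).
case: #|faces M| F euler => // f; rewrite subn1 /= => F eul _.
by move: E F eul; move: #|D| #|edges M| #|vertices M|; lia.
Qed.

End RootedMaps.

Definition num_triangulations_darts (m n p : nat) : nat :=
  #|equivalence_partition (@map_iso 'I_m)
      [set M : rooted_map 'I_m |
        triangulation_with_boundary p M & #|vertices M| == n]|.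

(** [T_n^(p)].  By [num_triangulations_large], no map with [6 * n] darts or more
    contributes, so the sum ranges over all sizes. The map with one vertex and no
    edge has no dart to serve as a root, hence the separate case [p = 0]. *)
Definition num_triangulations (n p : nat) : nat :=
  if p == 0%N then (n == 1%N) : nat
  else \sum_(m < 6 * n) num_triangulations_darts m n p.

Lemma num_triangulations_darts_eq0 m n p :
  (m + 2 * p + 6 != 6 * n)%N -> num_triangulations_darts m n p = 0%N.
Proof.
move=> neq; rewrite /num_triangulations_darts.
set S := [set M | _]; have -> : S = finset.set0.
  apply/setP => M; rewrite !inE; apply/negP => /andP[/card_darts Mm /eqP Mn].
  by move: neq; rewrite -Mn -Mm card_ord eqxx.
by rewrite /equivalence_partition imset0 cards0.
Qed.

Lemma num_triangulations_large m n p :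
  (6 * n <= m)%N -> num_triangulations_darts m n p = 0%N.
Proof. by move=> le_nm; apply: num_triangulations_darts_eq0; lia. Qed.

(** * Generating functions *)

(** [triangulation_gf p n] is [T_n^(p)]: the outer variable is [y], the inner
    one is [x]. *)
Definition triangulation_gf : fps (fps rat) :=
  Fps (fun p => Fps (fun n => (num_triangulations n p)%:R)).

Lemma unit_triangulation_denominator :
  1 - fps_divX (fps_theta (triangulation_gf 1%N)) \is a GRing.unit.
Proof.
rewrite unit_fps coef_fpsB coef_fps1 /= /num_triangulations /=.
by rewrite big1 ?mul0rn ?subr0 ?unitr1 // => m _; apply: num_triangulations_darts_eq0; lia.
Qed.

(* Main.v *)
(** A map is cut along its root edge.  To treat the one-vertex map uniformly, a
    rooted map is replaced by a planted one, with an extra half-edge in the root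
    corner; darts are labelled, so that planted maps on [k] darts are counted
    [k!] times each.  Cutting the root edge into two half-edges multiplies both
    the edge involution and the vertex permutation by a transposition.  If the
    edge has the external face on both sides, the map falls apart into two
    planted planar maps (by the genus inequality); otherwise it opens a
    triangle and the boundary grows by one.  This is Tutte's equation
    [T = x + y^2 T^2 + (T - x - y t) / y].

    Write [D = 1 - y + 2 y^3 T] for its derivative in [T].  Differentiating in
    [x] and in [y] expresses [D * T^dot] and [D * y T_y] through [T], and then
    the difference [G] of the two sides of the theorem, with [3 t^dot - 4 t]
    in place of twice the quotient, satisfies [D * G = 2 y^2 K] for a series
    [K] in [x] alone.  The coefficients of [G] in [x] are polynomials in [y],
    while [D = 1 - y + O(x)], so [K = 0] and [G = 0].  The equation [K = 0]
    says exactly that the quotient is [(3 t^dot - 4 t) / 2]. *)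

Require Import Defs.
From mathcomp Require Import all_boot all_order all_fingroup all_algebra.
From mathcomp Require Import boolp zify ring.

Set Implicit Arguments.
Unset Strict Implicit.
Unset Printing Implicit Defensive.

(** * Length and cycles of permutations, genus *)

(** Cutting produces maps on complementary sets of darts. Planted maps are therefore carried by
    subsets [S] of one ambient type [U], with permutations supported on [S], so that neither cutting
    nor gluing relabels anything. Returning to isomorphism classes costs only factorials, because a
    rooted map has no nontrivial automorphism; Euler's formula determines the number of darts from
    the number of vertices and the boundary length, and the binomials that distribute labels between
    two pieces cancel the factorials.

    Planarity is measured by [plen] instead of numbers of cycles: it ignores fixed points, in
    particular those outside [S], and changes by exactly one at each insertion, deletion, merging or
    splitting.

    In the algebra, [3 t^dot - 4 t] is forced. Put an unknown series [c] in [x] in its place in [G]: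
    after elimination [T] and its derivatives drop out of [D * G], the constant term in [y] is 0,
    and the coefficient of [y] is [6 t^dot - 8 t - 2 c]. It vanishes for this [c] only, and the
    coefficient of [y^2] is all that remains. *)

Section PermLength.
Variable U : finType.
Implicit Types (s t a : {perm U}) (x y z w : U) (A B S R : {set U}).

(* [mulgA] at the canonical instance found for [{perm U}], so that its results
   stay syntactically comparable. *)
Lemma permA s t a : ((s * t) * a = s * (t * a))%g.
Proof. by rewrite mulgA. Qed.

Lemma mulg_tpermK s y z : (s * tperm y z * tperm y z = s)%g.
Proof. by rewrite permA tperm2 mulg1. Qed.

Definition stable s A := [forall z in A, s z \in A].

Lemma stableP s A : reflect {in A, forall z, s z \in A} (stable s A).
Proof. exact: forall_inP. Qed.

Lemma stableE s A z : stable s A -> (s z \in A) = (z \in A).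
Proof.
move=> /stableP sA; have sAA : s @: A = A.
  apply/eqP; rewrite eqEcard card_imset ?leqnn ?andbT; last exact: perm_inj.
  by apply/subsetP => _ /imsetP[w wA ->]; apply: sA.
by rewrite -{1}sAA mem_imset //; apply: perm_inj.
Qed.

Lemma stable_porbit s x : stable s (porbit s x).
Proof.
by apply/stableP => z; rewrite -!eq_porbit_mem -(porbit_perm s 1 z) expg1.
Qed.

Lemma porbit_sub s x A : stable s A -> x \in A -> porbit s x \subset A.
Proof.
move=> sA xA; apply/subsetP => _ /porbitP[i ->].
elim: i => [|i IHi]; first by rewrite expg0 perm1.
by rewrite expgSr permM stableE.
Qed.

Lemma porbit_fix s x : s x = x -> porbit s x = [set x].
Proof.
move=> sx; apply/eqP; rewrite eqEsubset sub1set porbit_id andbT.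
by apply: porbit_sub; rewrite ?set11 //; apply/stableP => z /set1P->; rewrite sx set11.
Qed.

Lemma porbit_eq s x y : y \in porbit s x -> porbit s y = porbit s x.
Proof. by rewrite -eq_porbit_mem => /eqP. Qed.

Lemma porbit_perm1 s x : porbit s (s x) = porbit s x.
Proof. by have := porbit_perm s 1 x; rewrite expg1. Qed.

Lemma card_porbits_tperm_merge s y z : z \notin porbit s y ->
  #|porbits (tperm y z * s)%g|.+1 = #|porbits s|.
Proof.
move=> zs; have := porbits_mul_tperm s y z; rewrite porbit_sym zs.
have -> : y != z by apply: contraNneq zs => ->; apply: porbit_id.
by rewrite /=; lia.
Qed.

Lemma card_porbits_tperm_split s y z : z \in porbit s y -> y != z ->
  #|porbits (tperm y z * s)%g| = #|porbits s|.+1.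
Proof.
by move=> zs yz; have := porbits_mul_tperm s y z; rewrite porbit_sym zs yz /=; lia.
Qed.

Lemma tperm_stable y z A w : y \in A -> z \in A -> (tperm y z w \in A) = (w \in A).
Proof. by move=> yA zA; case: tpermP => // ->; rewrite yA zA. Qed.

(** Otherwise a second multiplication by [tperm y z] would merge cycles again and lose two cycles in
    all, whereas the two transpositions cancel. *)
Lemma porbit_tperm_merge_mem s y z : z \notin porbit s y ->
  z \in porbit (tperm y z * s)%g y.
Proof.
move=> zs; apply/negPn/negP => zt.
have := card_porbits_tperm_merge zt; have := card_porbits_tperm_merge zs.
by rewrite tpermKg; lia.
Qed.

Lemma porbit_tperm_merge s y z : z \notin porbit s y ->
  porbit (tperm y z * s)%g y = porbit s y :|: porbit s z.
Proof.
move=> zs; apply/eqP; rewrite eqEsubset; apply/andP; split.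
  apply: porbit_sub; last by rewrite inE porbit_id.
  have sA : stable s (porbit s y :|: porbit s z).
    by apply/stableP => w; rewrite !in_setU !(stableE _ (stable_porbit _ _)).
  by apply/stableP => w wA; rewrite permM stableE // tperm_stable // inE porbit_id ?orbT.
set O := porbit (_ * _) y; have yO : y \in O by apply: porbit_id.
have zO : z \in O by apply: porbit_tperm_merge_mem.
have sO : stable s O.
  apply/stableP => w wO; rewrite -[s](tpermKg y z) permM.
  by rewrite (stableE _ (stable_porbit _ _)) tperm_stable.
by rewrite subUset !porbit_sub.
Qed.

Lemma porbit_tperm_splitN s y z : z \in porbit s y -> y != z ->
  z \notin porbit (tperm y z * s)%g y.
Proof.
move=> zs yz; apply/negP => zt.
have := card_porbits_tperm_split zt yz; have := card_porbits_tperm_split zs yz.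
by rewrite tpermKg; lia.
Qed.

Lemma porbit_tperm_split s y z : z \in porbit s y -> y != z ->
  porbit s y = porbit (tperm y z * s)%g y :|: porbit (tperm y z * s)%g z.
Proof.
by move=> zs yz; rewrite -porbit_tperm_merge ?tpermKg // porbit_tperm_splitN.
Qed.

Lemma porbit_tperm_other s y z w : y \notin porbit s w -> z \notin porbit s w ->
  porbit (tperm y z * s)%g w = porbit s w.
Proof.
move=> ys zs; have tE u : u \in porbit s w -> tperm y z u = u.
  by move=> us; rewrite tpermD //; [apply: contraNneq ys | apply: contraNneq zs] => ->.
have e i : ((tperm y z * s) ^+ i)%g w = (s ^+ i)%g w.
  by elim: i => // i IHi; rewrite !expgSr !permM IHi tE ?mem_porbit.
by apply/setP => u; apply/porbitP/porbitP => -[i ->]; exists i; rewrite e.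
Qed.

Lemma card_porbit_tperm_merge s y z : z \notin porbit s y ->
  #|porbit (tperm y z * s)%g y| = #|porbit s y| + #|porbit s z|.
Proof.
move=> zs; rewrite porbit_tperm_merge // cardsU disjoint_setI0 ?cards0 ?subn0 //.
apply/pred0P => w /=; apply/negP => /andP[/porbit_eq yw /porbit_eq wz].
by move: zs; rewrite -yw wz porbit_id.
Qed.

Lemma card_porbit_tperm_split s y z : z \in porbit s y -> y != z ->
  #|porbit s y| = #|porbit (tperm y z * s)%g y| + #|porbit (tperm y z * s)%g z|.
Proof.
move=> zs yz; rewrite -card_porbit_tperm_merge ?tpermKg //.
exact: porbit_tperm_splitN.
Qed.

Lemma mulg_tperm s y z : (s * tperm y z = (tperm y z * s^-1)^-1)%g.
Proof. by rewrite invMg invgK tpermV. Qed.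

(* The distance to the identity in the Cayley graph of all transpositions. *)
Definition plen s := #|U| - #|porbits s|.

Lemma card_porbits_le s : #|porbits s| <= #|U|.
Proof. exact: leq_imset_card. Qed.

Lemma plenV s : plen s^-1 = plen s.
Proof. by rewrite /plen porbitsV. Qed.

Lemma plen1 : plen 1 = 0.
Proof.
rewrite /plen card_imset ?subnn // => x y; rewrite !porbit_fix ?perm1 //.
exact: set1_inj.
Qed.

Lemma plen_merge s y z : z \notin porbit s y -> plen (tperm y z * s) = (plen s).+1.
Proof.
move=> /card_porbits_tperm_merge; rewrite /plen.
by have := card_porbits_le s; lia.
Qed.

Lemma plen_split s y z : z \in porbit s y -> y != z ->
  (plen (tperm y z * s)).+1 = plen s.
Proof.
move=> zs yz; have := card_porbits_tperm_split zs yz; rewrite /plen.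
by have := card_porbits_le (tperm y z * s)%g; lia.
Qed.

Lemma plen_merger s y z : z \notin porbit s y -> plen (s * tperm y z) = (plen s).+1.
Proof. by move=> zs; rewrite mulg_tperm plenV plen_merge ?plenV ?porbitV. Qed.

Lemma plen_splitr s y z : z \in porbit s y -> y != z ->
  (plen (s * tperm y z)).+1 = plen s.
Proof. by move=> zs yz; rewrite mulg_tperm plenV plen_split ?plenV ?porbitV. Qed.

Lemma plen_tperm_ge s y z : plen s <= (plen (tperm y z * s)).+1.
Proof.
have [<-|yz] := eqVneq y z; first by rewrite tperm1 mul1g.
have [zs|zs] := boolP (z \in porbit s y); first by rewrite plen_split.
by rewrite plen_merge //; lia.
Qed.

Lemma plen_fix s y z : s z = z -> y != z -> plen (tperm y z * s) = (plen s).+1.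
Proof. by move=> sz yz; rewrite plen_merge // porbit_sym porbit_fix ?inE. Qed.

(* [(tperm y (s y) * s)] fixes [s y], so any property can be built up from the
   identity by attaching one fixed point at a time. *)
Lemma perm_fix_ind (P : {perm U} -> Prop) : P 1%g ->
  (forall s y z, s z = z -> y != z -> P s -> P (tperm y z * s)%g) ->
  forall s, P s.
Proof.
move=> P1 PS s; have [n] := ubnP (plen s); elim: n s => // n IHn s.
have [y sy|s1 _] := pickP (fun y => y != s y); last first.
  by have -> : s = 1%g by apply/permP => y; rewrite perm1; have /negbFE/eqP := s1 y.
move=> ln; have fz : (tperm y (s y) * s)%g (s y) = s y by rewrite permM tpermR.
rewrite -[s](tpermKg y (s y)); apply: PS => //; apply: IHn.
by have := plen_fix fz sy; rewrite tpermKg; lia.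
Qed.

(** Multiplying by [tperm z (s z)] on the right bypasses [z]: its predecessor is sent to [s z], and
    [z] becomes fixed. This is how darts are removed from vertices and faces; the inverse operation
    inserts [z] before a given point. *)
Lemma porbit_del s z w : w != z -> porbit (s * tperm z (s z)) w = porbit s w :\ z.
Proof.
move=> wz; have [sz|sz] := eqVneq (s z) z.
  rewrite sz tperm1 mulg1; apply/setP => u; rewrite !inE.
  have [->|//] := eqVneq; rewrite porbit_sym porbit_fix ?inE //.
  exact: negbTE.
set s' := (s * _)%g; have s'z : s' z = z by rewrite permM tpermR.
have P u : porbit s' u = porbit (tperm z (s z) * s^-1)%g u.
  by rewrite /s' mulg_tperm porbitV.
have zsz : s z \in porbit s^-1 z by rewrite porbitV -porbit_perm1 porbit_id.
have U' : porbit s z = z |: porbit s' (s z).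
  by rewrite -porbitV (porbit_tperm_split zsz) 1?eq_sym // -!P porbit_fix.
have [wsz|wsz] := boolP (w \in porbit s z).
  have : w \in porbit s' (s z) by move: wsz; rewrite U' !inE (negbTE wz).
  move=> ws'; rewrite (porbit_eq ws') (porbit_eq wsz) U' setU1K //.
  by rewrite porbit_sym porbit_fix ?inE.
have zw : z \notin porbit s w by rewrite porbit_sym.
rewrite P porbit_tperm_other ?porbitV //; last by rewrite porbit_sym porbit_perm1.
apply/setP => u; rewrite !inE; have [->|//] := eqVneq; exact: negbTE.
Qed.

Lemma plen_del s z : s z != z -> (plen (s * tperm z (s z))).+1 = plen s.
Proof.
by move=> sz; rewrite plen_splitr ?[z == _]eq_sym // -porbit_perm1 porbit_id.
Qed.

Lemma plen_ins s y z : s z = z -> y != z -> plen (s * tperm z y) = (plen s).+1.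
Proof. by move=> sz yz; rewrite plen_merger // porbit_fix ?inE. Qed.

(* For [R = [set x]] this is the transitivity of the group generated by [a] and
   [s]; see [transitive_generates]. *)
Definition generates a s R :=
  [forall A : {set U}, [&& R \subset A, stable a A & stable s A] ==> (A == setT)].

Lemma generatesP a s R : reflect (forall A, R \subset A -> stable a A ->
  stable s A -> forall z, z \in A) (generates a s R).
Proof.
apply: (iffP forallP) => gen A.
  move=> RA aA sA z; have := gen A; rewrite RA aA sA => /eqP->; exact: in_setT.
by apply/implyP => /and3P[RA aA sA]; apply/eqP/setP => z; rewrite in_setT gen.
Qed.

Definition gen_closure a s R : {set U} :=
  \bigcap_(A : {set U} | [&& R \subset A, stable a A & stable s A]) A.

Lemma sub_gen_closure a s R : R \subset gen_closure a s R.
Proof. by apply/bigcapsP => A /and3P[]. Qed.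

Lemma gen_closure_stable a s R : stable a (gen_closure a s R) /\ stable s (gen_closure a s R).
Proof.
split; apply/stableP => z /bigcapP zR; apply/bigcapP => A RA;
  have /and3P[_ aA sA] := RA; rewrite stableE //; exact: zR.
Qed.

Lemma gen_closure_min a s R A :
  R \subset A -> stable a A -> stable s A -> gen_closure a s R \subset A.
Proof. by move=> RA aA sA; apply: bigcap_inf; rewrite RA aA. Qed.

(* In numbers of cycles: [c(a) + c(s) + c(a * s) <= #|U| + 2 * #|R|]. *)
Lemma genus_ge0 a s R : generates a s R ->
  2 * #|U| <= plen a + plen s + plen (a * s) + 2 * #|R|.
Proof.
elim/perm_fix_ind: a R => [|a y z az yz IHa] R gen.
  (* For [a = 1] the length of [s] is counted twice, and every cycle of [s] has to meet [R]. *)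
  rewrite mul1g plen1 /plen; suff : #|porbits s| <= #|R| by lia.
  suff -> : porbits s = porbit s @: R by apply: leq_imset_card.
  apply/eqP; rewrite eqEsubset; apply/andP; split; last first.
    by apply/subsetP => _ /imsetP[w _ ->]; apply: imset_f.
  apply/subsetP => _ /imsetP[w _ ->].
  have sA : stable s [set w | porbit s w \in porbit s @: R].
    by apply/stableP => u; rewrite !inE porbit_perm1.
  have /generatesP/(_ _ _ _ sA w) := gen; rewrite inE; apply.
    by apply/subsetP => u uR; rewrite inE imset_f.
  by apply/stableP => u; rewrite perm1.
rewrite plen_fix // permA.
have gen' A : R \subset A -> stable a A -> stable s A ->
    (y \in A) = (z \in A) -> forall w, w \in A.
  move=> RA aA sA yzA; move/generatesP: gen; apply => //.
  apply/stableP => w wA; rewrite permM stableE //.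
  by case: tpermP => [e|e|//]; [rewrite -yzA -e | rewrite yzA -e].
(* If [R] still reaches everything without the transposition, the length gained by [a] pays for the
   possible loss of one in [a * s]. *)
have [/IHa|ngen] := boolP (generates a s R).
  have := plen_tperm_ge (a * s) y z. lia.
(* Otherwise exactly one of [y] and [z] is reachable from [R], so the transposition merges two
   cycles of [a * s]. Both lengths grow by one, which pays for adding the unreachable point [u] to
   the seeds. *)
set C := gen_closure a s R; have [aC sC] := gen_closure_stable a s R.
have yzC : (y \in C) != (z \in C).
  apply: contra ngen => /eqP yzC; apply/generatesP => A RA aA sA w.
  have wC : w \in C by apply: gen' => //; apply: sub_gen_closure.
  exact: (subsetP (gen_closure_min RA aA sA)).
have -> : plen (tperm y z * (a * s)) = (plen (a * s)).+1.
  apply: plen_merge; apply: contra yzC => zy.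
  have asC : stable (a * s) C by apply/stableP => w wC; rewrite permM !stableE.
  apply/eqP; apply/idP/idP => [yC | zC]; first exact: (subsetP (porbit_sub asC yC)).
  by move: zy; rewrite porbit_sym; apply: (subsetP (porbit_sub asC zC)).
have [u uyz uC] : exists2 u, (u == y) || (u == z) & u \notin C.
  have [yC|yC] := boolP (y \in C); last by exists y; rewrite ?eqxx.
  by exists z; rewrite ?eqxx ?orbT //; move: yzC; rewrite yC; case: (z \in C).
have uR : #|u |: R| <= #|R|.+1 by rewrite cardsU1 -add1n leq_add2r leq_b1.
suff gen2 : generates a s (u |: R).
  by apply: leq_trans (IHa _ gen2) _; move: uR; clear; lia.
apply/generatesP => A; rewrite subUset sub1set => /andP[uA RA] aA sA.
apply: gen' => //; have /subsetP CA := gen_closure_min RA aA sA.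
case/orP: uyz uA uC yzC => /eqP-> uA /negbTE uC; rewrite uC uA.
  by case zC: (z \in C) => // _; rewrite CA.
by case yC: (y \in C) => // _; rewrite CA.
Qed.

End PermLength.

(** * Planted maps *)

Section Planted.
Variable U : finType.
Implicit Types (s t a : {perm U}) (x y z w r : U) (A B S R C D : {set U}).

(** A planted map: a map on the darts [S] together with a half-edge [x], the
    only fixed point of [a], sitting in the root corner just before the root
    dart [s x].  Its external face has degree [p], the half-edge not counted.
    The single vertex is thus no exception: it is [S = [set x]].  As [plen a] is
    the number of edges, [pl_len] is Euler's formula. *)
Record is_planted S p a s x : Prop := IsPlanted {
  pl_root : x \in S;
  pl_ona : perm_on S a;
  pl_ons : perm_on S s;
  pl_ax : a x = x;
  pl_afix : forall y, y \in S -> y != x -> a y != y;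
  pl_inv : forall y, a (a y) = y;
  pl_gen : generates a s (x |: ~: S);
  pl_len : plen a + plen s + plen (a * s) = 2 * #|S|.-1;
  pl_ext : #|porbit (a * s) x| = p.+1;
  pl_tri : forall y, y \in S -> y \notin porbit (a * s) x ->
    #|porbit (a * s) y| = 3 }.

Definition planted S p (M : rooted_map U) : bool :=
  `[< is_planted S p (alpha M) (sigma M) (Defs.root M) >].

Lemma plantedP S p a s x : reflect (is_planted S p a s x) (planted S p (a, s, x)).
Proof. exact: asboolP. Qed.

Lemma perm_onS A B s : A \subset B -> perm_on A s -> perm_on B s.
Proof. by move=> AB /subset_trans; apply. Qed.

Lemma perm_on_tperm A y z : y \in A -> z \in A -> perm_on A (tperm y z).
Proof.
by move=> yA zA; apply: perm_onS (tperm_on y z); rewrite subUset !sub1set yA.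
Qed.

Lemma perm_on_stable A s : perm_on A s -> stable s A.
Proof. by move=> As; apply/stableP => z; rewrite perm_closed. Qed.

Lemma stableC s A : stable s A -> stable s (~: A).
Proof. by move=> sA; apply/stableP => z; rewrite !inE stableE. Qed.

Lemma stableU s A B : stable s A -> stable s B -> stable s (A :|: B).
Proof. by move=> sA sB; apply/stableP => z; rewrite !inE !stableE. Qed.

Lemma stable_tperm y z A : y \in A -> z \in A -> stable (tperm y z) A.
Proof. by move=> yA zA; apply/stableP => w wA; rewrite tperm_stable. Qed.

Lemma stableM s t A : stable s A -> stable t A -> stable (s * t) A.
Proof. by move=> sA tA; apply/stableP => w wA; rewrite permM !stableE. Qed.

Lemma stable1 s z : s z = z -> stable s [set z].
Proof. by move=> sz; apply/stableP => w /set1P->; rewrite sz set11. Qed.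

Section DisjointSupport.
Variables (C D : {set U}) (dCD : [disjoint C & D]).
Variables (s t : {perm U}) (Cs : perm_on C s) (Dt : perm_on D t).

Lemma disjL z : z \in C -> z \notin D.
Proof. by move=> zC; rewrite (disjointFr dCD zC). Qed.

Lemma disjR z : z \in D -> z \notin C.
Proof. by move=> zD; rewrite (disjointFl dCD zD). Qed.

Lemma disj_permL z : z \in C -> (s * t)%g z = s z.
Proof. by move=> zC; rewrite permM (out_perm Dt) ?disjL // perm_closed. Qed.

Lemma disj_permR z : z \in D -> (s * t)%g z = t z.
Proof. by move=> zD; rewrite permM (out_perm Cs) ?disjR. Qed.

Lemma disj_perm_out z : z \notin C -> z \notin D -> (s * t)%g z = z.
Proof. by move=> zC zD; rewrite permM (out_perm Cs) ?(out_perm Dt). Qed.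

Lemma disj_permC : (s * t = t * s)%g.
Proof.
exact: (perm_onC Cs Dt dCD).
Qed.
End DisjointSupport.

Lemma porbit_agree s t A z : stable s A -> {in A, s =1 t} -> z \in A ->
  porbit t z = porbit s z.
Proof.
move=> sA st zA; have e i : (t ^+ i)%g z = (s ^+ i)%g z.
  elim: i => [|i IHi]; first by rewrite !expg0 !perm1.
  rewrite !expgSr !permM IHi st //.
  exact: (subsetP (porbit_sub sA zA)) (mem_porbit _ _ _).
by apply/setP => u; apply/porbitP/porbitP => -[i ->]; exists i; rewrite e.
Qed.

Lemma plen_disj C D s t : [disjoint C & D] -> perm_on C s -> perm_on D t ->
  plen (s * t) = plen s + plen t.
Proof.
move=> dCD Cs Dt; elim/perm_fix_ind: s Cs => [|s y z sz yz IHs] Cs.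
  by rewrite mul1g plen1.
have zy : (tperm y z * s)%g z != z.
  by rewrite permM tpermR -[X in _ != X]sz (inj_eq perm_inj).
have zC : z \in C by apply: contraNT zy => /(out_perm Cs)->.
have yC : y \in C.
  apply: contraNT yz => /(out_perm Cs); rewrite permM tpermL sz => ->.
  exact: eqxx.
have Cs' : perm_on C s.
  by rewrite -[s](tpermKg y z) perm_onM // perm_on_tperm.
rewrite permA plen_fix // ?IHs // ?plen_fix //.
by rewrite permM sz (out_perm Dt) // (disjL dCD).
Qed.

End Planted.

(** * Cutting and gluing along the root edge *)

Section Glue.
Variable U : finType.
Implicit Types (s t a : {perm U}) (x y z w r : U) (A B S R C D : {set U}).

(** Connectedness of a planted map seen from inside a larger one: adding [~: C] to [A] yields a set
    stable under the original permutations, to which [pl_gen] applies. *)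
Lemma planted_sub C p a s r a' s' A : is_planted C p a s r -> {in C, a =1 a'} ->
  {in C, s =1 s'} -> r \in A -> stable a' A -> stable s' A -> C \subset A.
Proof.
move=> P aa ss rA aA sA; apply/subsetP => z zC.
suff : z \in A :|: ~: C by rewrite !inE zC orbF.
have stab t t' : perm_on C t -> stable t' A -> {in C, t =1 t'} -> stable t (A :|: ~: C).
  move=> Ct tA tt; apply/stableP => w; rewrite !inE (perm_closed w Ct).
  case wC: (w \in C) => /=; last by rewrite !orbT.
  by rewrite !orbF tt // stableE.
move/generatesP: (pl_gen P); apply.
- rewrite subUset sub1set inE rA /=; exact: subsetUr.
- exact: stab (pl_ona P) aA aa.
exact: stab (pl_ons P) sA ss.
Qed.

(* Joining two planted maps by an edge between their half-edges [r1] and [r2];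
   [x] is the half-edge of the result. *)
Section Glue2.
Variables (x : U) (C D : {set U}) (p q : nat).
Variables (a1 s1 a2 s2 : {perm U}) (r1 r2 : U).
Hypotheses (P1 : is_planted C p a1 s1 r1) (P2 : is_planted D q a2 s2 r2).
Hypotheses (dCD : [disjoint C & D]) (xC : x \notin C) (xD : x \notin D).

Let a' : {perm U} := (a1 * a2)%g.
Let s' : {perm U} := (s1 * s2)%g.
(** The two half-edges become the two darts of the new edge, and [x] is inserted just before [r2] in
    the rotation, so that [r2] is the root dart. *)
Let a : {perm U} := (tperm r2 r1 * a')%g.
Let s : {perm U} := (s' * tperm x r2)%g.
Let S := x |: (C :|: D).

Let r1C : r1 \in C := pl_root P1.
Let r2D : r2 \in D := pl_root P2.
Let aC z (zC : z \in C) : a1 z = a' z :=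
  esym (disj_permL dCD (pl_ona P1) (pl_ona P2) zC).
Let aD z (zD : z \in D) : a2 z = a' z :=
  esym (disj_permR dCD a2 (pl_ona P1) zD).
Let sC z (zC : z \in C) : s1 z = s' z :=
  esym (disj_permL dCD (pl_ons P1) (pl_ons P2) zC).
Let sD z (zD : z \in D) : s2 z = s' z :=
  esym (disj_permR dCD s2 (pl_ons P1) zD).

Let a'r1 : a' r1 = r1. Proof. by rewrite -aC // (pl_ax P1). Qed.
Let a'r2 : a' r2 = r2. Proof. by rewrite -aD // (pl_ax P2). Qed.
Let r12 : r1 != r2. Proof. by apply: contraTneq r1C => ->; rewrite (disjR dCD). Qed.
Let xr1 : x != r1. Proof. by apply: contraNneq xC => ->. Qed.
Let xr2 : x != r2. Proof. by apply: contraNneq xD => ->. Qed.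
Let a'x : a' x = x.
Proof. exact: disj_perm_out (pl_ona P1) (pl_ona P2) _ xC xD. Qed.
Let s'x : s' x = x.
Proof. exact: disj_perm_out (pl_ons P1) (pl_ons P2) _ xC xD. Qed.

Lemma glue2_sx : s x = r2. Proof. by rewrite /s permM s'x tpermL. Qed.
Lemma glue2_ar : a r2 = r1. Proof. by rewrite /a permM tpermL. Qed.

Lemma glue2_sub A : stable a' A -> stable s' A ->
  (r1 \in A -> C \subset A) /\ (r2 \in A -> D \subset A).
Proof. by move=> aA sA; split=> rA; [apply: (planted_sub P1 aC sC) | apply: (planted_sub P2 aD sD)]. Qed.

Let phi' : {perm U} := (a' * s')%g.
Let phiE : (phi' = (a1 * s1) * (a2 * s2))%g.
Proof.
rewrite /phi' /a' /s' !permA -[(a2 * (s1 * s2))%g]permA.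
by rewrite -(disj_permC dCD (pl_ons P1) (pl_ona P2)) permA.
Qed.

Let fC : perm_on C (a1 * s1)%g. Proof. exact: perm_onM (pl_ona P1) (pl_ons P1). Qed.
Let fD : perm_on D (a2 * s2)%g. Proof. exact: perm_onM (pl_ona P2) (pl_ons P2). Qed.
Let phiC z : z \in C -> porbit phi' z = porbit (a1 * s1) z.
Proof.
move=> zC; rewrite phiE; apply: (porbit_agree (perm_on_stable fC)) zC => w wC.
by rewrite (disj_permL dCD fC fD).
Qed.
Let phiD z : z \in D -> porbit phi' z = porbit (a2 * s2) z.
Proof.
move=> zD; rewrite phiE; apply: (porbit_agree (perm_on_stable fD)) zD => w wD.
by rewrite (disj_permR dCD _ fC).
Qed.

(** The faces of the disjoint union, with [x] inserted before [r2]. The new edge then contributes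
    only a transposition on the left, which merges the faces of [r1] and [r2]. *)
Let psi : {perm U} := (phi' * tperm x r2)%g.
Let phi'x : phi' x = x. Proof. by rewrite permM a'x s'x. Qed.
Let psiE : (a * s = tperm r2 r1 * psi)%g.
Proof. by rewrite /a /s /psi /phi' !permA. Qed.
Let psix : psi x = r2. Proof. by rewrite /psi permM phi'x tpermL. Qed.
Let psidel : phi' = (psi * tperm x (psi x))%g.
Proof. by rewrite psix /psi mulg_tpermK. Qed.
Let psi_porb w : w != x -> porbit phi' w = porbit psi w :\ x.
Proof. by move=> wx; rewrite psidel porbit_del. Qed.

Let sub2 : porbit phi' r2 \subset D.
Proof. by rewrite phiD // porbit_sub // perm_on_stable. Qed.

Let psi_r2 : porbit psi r2 = x |: porbit phi' r2.
Proof.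
rewrite psi_porb 1?eq_sym // setD1K //.
by rewrite -psix porbit_perm1 porbit_id.
Qed.
Let psi_r1 : porbit psi r1 = porbit phi' r1.
Proof.
have r1N : r1 \notin porbit psi r2.
  rewrite psi_r2 !inE eq_sym (negbTE xr1) /=.
  by apply/negP => /(subsetP sub2); apply/negP/(disjL dCD).
rewrite psi_porb 1?eq_sym //; apply/setP => w; rewrite !inE.
have [->|//] := eqVneq w x; apply: contraNF r1N => xr.
by rewrite -psix porbit_perm1 (porbit_eq xr) porbit_id.
Qed.

Let r1psi : r1 \notin porbit psi r2.
Proof.
rewrite psi_r2 !inE eq_sym (negbTE xr1) /=.
by apply/negP => /(subsetP sub2); apply/negP/(disjL dCD).
Qed.

Lemma glue2_face : porbit (a * s) x = porbit psi r2 :|: porbit psi r1.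
Proof.
rewrite psiE -porbit_tperm_merge //; apply: porbit_eq.
by rewrite porbit_tperm_merge // psi_r2 !inE eqxx.
Qed.

Lemma glue2_card : #|S| = (#|C| + #|D|).+1.
Proof. by rewrite /S cardsU1 !inE negb_or xC xD cardsU disjoint_setI0 ?cards0 ?subn0. Qed.

Lemma glue2_case : a (s x) \in porbit (a * s) x.
Proof. by rewrite glue2_sx glue2_ar glue2_face in_setU porbit_id orbT. Qed.

Lemma glue2_planted : is_planted S (p + q).+2 a s x.
Proof.
have a'inv y : a' (a' y) = y.
  have [yC|yC] := boolP (y \in C).
    by rewrite -aC // -aC ?(perm_closed _ (pl_ona P1)) // (pl_inv P1).
  have [yD|yD] := boolP (y \in D).
    by rewrite -aD // -aD ?(perm_closed _ (pl_ona P2)) // (pl_inv P2).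
  by rewrite /a' !(disj_perm_out (pl_ona P1) (pl_ona P2)).
have CS : C \subset S by rewrite /S setUCA subsetUl.
have DS : D \subset S by rewrite /S setUA subsetUr.
have xS : x \in S by rewrite !inE eqxx.
have r1S : r1 \in S := subsetP CS _ r1C.
have r2S : r2 \in S := subsetP DS _ r2D.
have ar1 : a r1 = r2 by rewrite permM tpermR.
have aE y : y != r1 -> y != r2 -> a y = a' y.
  by move=> y1 y2; rewrite permM tpermD // eq_sym.
have aS : perm_on S a.
  by rewrite !perm_onM ?perm_on_tperm ?(perm_onS CS (pl_ona P1)) ?(perm_onS DS (pl_ona P2)).
have sS : perm_on S s.
  by rewrite !perm_onM ?perm_on_tperm ?(perm_onS CS (pl_ons P1)) ?(perm_onS DS (pl_ons P2)).
split => //.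
- by rewrite aE.
- move=> y; have [->|y1] := eqVneq y r1; first by rewrite ar1 [r2 == _]eq_sym.
  have [->|y2] := eqVneq y r2; first by rewrite glue2_ar.
  rewrite !inE aE // => /orP[->//|/orP[yC|yD] _].
    by rewrite -aC // (pl_afix P1).
  by rewrite -aD // (pl_afix P2).
- move=> y; have [->|y1] := eqVneq y r1; first by rewrite ar1 glue2_ar.
  have [->|y2] := eqVneq y r2; first by rewrite glue2_ar.
  have ne u : a' u = u -> y != u -> a' y != u.
    by move=> au yu; rewrite -[X in _ != X]au (inj_eq perm_inj).
  by rewrite (aE y) // aE ?a'inv // ne.
- apply/generatesP => A; rewrite subUset sub1set => /andP[xA SA] aA sA.
  have r2A : r2 \in A by rewrite -glue2_sx stableE.
  have r1A : r1 \in A by rewrite -glue2_ar stableE.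
  have a'A : stable a' A.
    by rewrite -[a'](tpermKg r2 r1) stableM // stable_tperm.
  have s'A : stable s' A.
    have -> : s' = (s * tperm x r2)%g by rewrite /s mulg_tpermK.
    by rewrite stableM // stable_tperm.
  have [/(_ r1A) CA /(_ r2A) DA] := glue2_sub a'A s'A.
  move=> z; case zS: (z \in S); last by apply: (subsetP SA); rewrite inE zS.
  move: zS; rewrite !inE => /orP[/eqP->//|/orP[]]; exact: subsetP.
(* The edge, the insertion of [x] at the vertex, its insertion in the face and the merging of faces
   each add one. The total of four is exactly the growth of [2 * #|S|.-1] over the sum for [C] and
   [D]. *)
- rewrite psiE plen_merge // /psi plen_ins // 1?eq_sym // /a plen_fix // 1?eq_sym //.
  rewrite /s plen_ins // 1?eq_sym // phiE (plen_disj dCD fC fD) glue2_card.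
  rewrite /a' /s' (plen_disj dCD (pl_ona P1) (pl_ona P2)) (plen_disj dCD (pl_ons P1) (pl_ons P2)).
  have := pl_len P1; have := pl_len P2; have : 0 < #|C| by apply/card_gt0P; exists r1.
  have : 0 < #|D| by apply/card_gt0P; exists r2.
  clear; lia.
(* The half-edges [r1] and [r2], so far not counted in the degrees, are now two sides of the
   external face; [x] is the new uncounted one. *)
- rewrite glue2_face -porbit_tperm_merge // card_porbit_tperm_merge // psi_r2 psi_r1.
  rewrite cardsU1 (phiC r1C) (phiD r2D) (pl_ext P1) (pl_ext P2).
  case: (boolP (x \in _)) => [|_]; last by rewrite add1n !addSn !addnS addnC.
  by move/(subsetP (porbit_sub (perm_on_stable fD) r2D)); rewrite (negbTE xD).
move=> y yS; rewrite glue2_face in_setU negb_or => /andP[y2 y1].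
rewrite psiE porbit_tperm_other 1?porbit_sym //.
have yx : y != x by apply: contraNneq y2 => ->; rewrite psi_r2 !inE eqxx.
have -> : porbit psi y = porbit phi' y.
  rewrite psi_porb //; apply/setP => w; rewrite !inE.
  have [->|//] := eqVneq w x; apply: contraNF y2 => xy.
  by rewrite -psix porbit_perm1 porbit_sym.
move: yS; rewrite !inE (negbTE yx) /= => /orP[yC|yD].
  by rewrite (phiC yC) (pl_tri P1) // -(phiC r1C) -psi_r1.
rewrite (phiD yD) (pl_tri P2) // -(phiD r2D).
by apply: contra y2; rewrite psi_r2 inE => ->; rewrite orbT.
Qed.

End Glue2.
End Glue.

(** * Reversing the two gluings: uniqueness and existence of the pieces *)

Section Cut2.
Variable U : finType.
Implicit Types (s t a : {perm U}) (x y z w r : U) (A B S R C D : {set U}).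

Lemma eq_perm_on C s t : perm_on C s -> perm_on C t -> {in C, s =1 t} -> s = t.
Proof.
move=> Cs Ct st; apply/permP => z; have [/st//|zC] := boolP (z \in C).
by rewrite !(out_perm _ zC).
Qed.

(** From the result, [r2] is read off as [s x] and [r1] as [a r2]. Once the edge is cancelled, [C]
    and [D] are the components of [r1] and [r2], and the permutations are restrictions to them. *)
Lemma glue2_inj x C D p q a1 s1 r1 a2 s2 r2 C' D' p' q' b1 t1 w1 b2 t2 w2 :
  is_planted C p a1 s1 r1 -> is_planted D q a2 s2 r2 ->
  [disjoint C & D] -> x \notin C -> x \notin D ->
  is_planted C' p' b1 t1 w1 -> is_planted D' q' b2 t2 w2 ->
  [disjoint C' & D'] -> x \notin C' -> x \notin D' ->
  (tperm r2 r1 * (a1 * a2) = tperm w2 w1 * (b1 * b2))%g ->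
  (s1 * s2 * tperm x r2 = t1 * t2 * tperm x w2)%g ->
  (C, (a1, s1, r1), (a2, s2, r2)) = (C', (b1, t1, w1), (b2, t2, w2)).
Proof.
move=> P1 P2 d xC xD P1' P2' d' xC' xD' ea es.
have e2 : r2 = w2.
  by rewrite -(glue2_sx P1 P2 xC xD) -(glue2_sx P1' P2' xC' xD') es.
have e1 : r1 = w1.
  by rewrite -(glue2_ar P1 P2 d) -(glue2_ar P1' P2' d') ea e2.
move: P1' P2' ea es; rewrite -e1 -e2 => P1' P2' /mulgI ea /mulIg es.
have st (E1 E2 : {set U}) t u : [disjoint E1 & E2] -> perm_on E1 t -> perm_on E2 u ->
    stable (t * u) E1 /\ stable (t * u) E2.
  move=> dE Et Eu; split; apply/stableP => z zE.
    by rewrite (disj_permL dE Et Eu) // perm_closed.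
  by rewrite (disj_permR dE _ Et) // perm_closed.
have [CC' DD'] : C \subset C' /\ D \subset D'.
  have [aC' aD'] := st _ _ _ _ d' (pl_ona P1') (pl_ona P2').
  have [sC' sD'] := st _ _ _ _ d' (pl_ons P1') (pl_ons P2').
  rewrite -ea -es in aC' aD' sC' sD'.
  have [/(_ (pl_root P1')) -> _] := glue2_sub P1 P2 d aC' sC'.
  by have [_ /(_ (pl_root P2')) ->] := glue2_sub P1 P2 d aD' sD'.
have [C'C D'D] : C' \subset C /\ D' \subset D.
  have [aC aD] := st _ _ _ _ d (pl_ona P1) (pl_ona P2).
  have [sC sD] := st _ _ _ _ d (pl_ons P1) (pl_ons P2).
  rewrite ea es in aC aD sC sD.
  have [/(_ (pl_root P1)) -> _] := glue2_sub P1' P2' d' aC sC.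
  by have [_ /(_ (pl_root P2)) ->] := glue2_sub P1' P2' d' aD sD.
have eC : C = C' by apply/eqP; rewrite eqEsubset CC'.
have eD : D = D' by apply/eqP; rewrite eqEsubset DD'.
move: P1' P2' d'; rewrite -eC -eD => P1' P2' d'.
have eq (E1 E2 : {set U}) t u t' u' : [disjoint E1 & E2] -> perm_on E1 t -> perm_on E2 u ->
    perm_on E1 t' -> perm_on E2 u' -> (t * u = t' * u')%g -> t = t' /\ u = u'.
  move=> dE t1E u2E t1E' u2E' e; split; [apply: (eq_perm_on t1E t1E')|apply: (eq_perm_on u2E u2E')] => z zE.
    by rewrite -(disj_permL dE t1E u2E) // e (disj_permL dE t1E' u2E').
  by rewrite -(disj_permR dE _ t1E) // e (disj_permR dE _ t1E').
have [-> ->] := eq _ _ _ _ _ _ d (pl_ona P1) (pl_ona P2) (pl_ona P1') (pl_ona P2') ea.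
by have [-> ->] := eq _ _ _ _ _ _ d (pl_ons P1) (pl_ons P2) (pl_ons P1') (pl_ons P2') es.
Qed.

Lemma restrE C s : stable s C -> {in C, restr_perm C s =1 s}.
Proof.
move=> sC w wC; apply: restr_permE => //; rewrite inE /=; apply/andP; split; first exact: in_setT.
by rewrite inE; apply/subsetP => z zC; rewrite inE /= apermE stableE.
Qed.

Section Component.
Variables (a s : {perm U}) (c : U).
Let C := gen_closure a s [set c].
Let aC : stable a C := proj1 (gen_closure_stable a s [set c]).
Let sC : stable s C := proj2 (gen_closure_stable a s [set c]).
Let a1 := restr_perm C a.
Let s1 := restr_perm C s.

Lemma mem_gen_closure1 : c \in C.
Proof. by rewrite -sub1set sub_gen_closure. Qed.

Lemma gen_closure1_sub A : c \in A -> stable a A -> stable s A -> C \subset A.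
Proof. by move=> cA; apply: gen_closure_min; rewrite sub1set. Qed.

Lemma component_generates : generates a1 s1 (c |: ~: C).
Proof.
apply/generatesP => A; rewrite subUset sub1set => /andP[cA CA] aA sA z.
have [zC|zC] := boolP (z \in C); last by apply: (subsetP CA); rewrite inE.
suff /subsetP/(_ z zC) : C \subset A :&: C by rewrite inE => /andP[].
apply: gen_closure1_sub; first by rewrite inE cA mem_gen_closure1.
  apply/stableP => w; rewrite !inE => /andP[wA wC].
  by rewrite -{1}(restrE aC wC) !stableE ?wA.
apply/stableP => w; rewrite !inE => /andP[wA wC].
by rewrite -{1}(restrE sC wC) !stableE ?wA.
Qed.

(** The genus inequality for one component, with all points outside [C] as additional seeds. When
    the bounds for two components add up to the known total, both are equalities, so both components
    are planar. *)
Lemma component_len : 2 * #|C|.-1 <= plen a1 + plen s1 + plen (a1 * s1).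
Proof.
have cC : #|c |: ~: C| = #|~: C|.+1 by rewrite cardsU1 in_setC negbK mem_gen_closure1.
move: cC (genus_ge0 component_generates) => ->.
have := cardsC C; have : 0 < #|C| by apply/card_gt0P; exists c; apply: mem_gen_closure1.
clear; lia.
Qed.

Lemma component_porbit z : z \in C -> porbit (a1 * s1) z = porbit (a * s) z.
Proof.
move=> zC; apply: (porbit_agree (stableM aC sC)) zC => w wC.
by rewrite !permM !restrE // stableE.
Qed.

Lemma component_planted : a c = c -> (forall y, a (a y) = y) ->
  {in C, forall y, y != c -> a y != y} ->
  {in C, forall y, y \notin porbit (a * s) c -> #|porbit (a * s) y| = 3} ->
  plen a1 + plen s1 + plen (a1 * s1) = 2 * #|C|.-1 ->
  is_planted C #|porbit (a * s) c|.-1 a1 s1 c.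
Proof.
move=> ac aa aN tri len; have cC := mem_gen_closure1.
split; rewrite ?restr_perm_on ?restrE ?component_porbit //.
- by move=> y yC; rewrite restrE //; apply: aN.
- move=> y; have [yC|yC] := boolP (y \in C); first by rewrite !restrE ?stableE.
  by rewrite !(out_perm (restr_perm_on _ _)).
- exact: component_generates.
- by case: #|_| (card_porbit_neq0 (a * s) c).
by move=> y yC; rewrite component_porbit //; apply: tri.
Qed.
End Component.

(** As [a] fixes [x], a fixed point [x] of [s] would be a whole connected component. *)
Lemma planted_sx S p a s x : is_planted S p a s x -> S != [set x] -> s x != x.
Proof.
move=> P; apply: contraNneq => sx; rewrite eqEsubset sub1set (pl_root P) andbT.
apply/subsetP => z zS; move/generatesP: (pl_gen P) => /(_ (x |: ~: S) (subxx _)).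
have st t : perm_on S t -> t x = x -> stable t (x |: ~: S).
  by move=> St tx; apply: stableU (stable1 tx) _; apply/stableC/perm_on_stable.
move=> /(_ (st _ (pl_ona P) (pl_ax P)) (st _ (pl_ons P) sx) z).
by rewrite !inE zS orbF.
Qed.

Lemma porbit3 t y : #|porbit t y| = 3 ->
  [/\ t (t (t y)) = y, t y != y, t (t y) != y & t (t y) != t y].
Proof.
move=> c3; have := iter_porbit t y; have := uniq_traject_porbit t y.
rewrite c3 /= !inE negb_or andbT => /andP[/andP[h1 h2] h3] ->.
by split; rewrite // eq_sym.
Qed.

Section Cut.
Variables (S : {set U}) (p : nat) (a s : {perm U}) (x : U).
Hypotheses (P : is_planted S p a s x) (S1 : S != [set x]).
(** [r] and [r'] are the two darts of the root edge. In [a'] this edge is cut into two half-edges,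
    in [s'] and [psi] the dart [x] is bypassed. Hence [phi'], the faces after cutting, differs from
    [psi] by one transposition, which splits a face or merges two according to whether [r'] lies on
    the external face. *)
Let r := s x.
Let r' := a r.
Let phi : {perm U} := (a * s)%g.
Let psi : {perm U} := (phi * tperm x r)%g.
Let a' : {perm U} := (tperm r r' * a)%g.
Let s' : {perm U} := (s * tperm x r)%g.
Let phi' : {perm U} := (a' * s')%g.

Lemma cut_rx : r != x. Proof. exact: planted_sx P S1. Qed.
Lemma cut_rS : r \in S. Proof. by rewrite (perm_closed _ (pl_ons P)) (pl_root P). Qed.
Lemma cut_r'S : r' \in S. Proof. by rewrite (perm_closed _ (pl_ona P)) cut_rS. Qed.
Lemma cut_r'x : r' != x.
Proof. by rewrite -(pl_ax P) (inj_eq perm_inj) cut_rx. Qed.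
Lemma cut_rr' : r != r'.
Proof. by rewrite eq_sym; apply: (pl_afix P cut_rS cut_rx). Qed.
Lemma cut_ar' : a r' = r. Proof. exact: (pl_inv P). Qed.
Lemma cut_phix : phi x = r. Proof. by rewrite permM (pl_ax P). Qed.
Lemma cut_phi'E : phi' = (tperm r r' * psi)%g.
Proof. by rewrite /phi' /a' /s' /psi /phi !permA. Qed.
Lemma cut_a'r : a' r = r. Proof. by rewrite permM tpermL cut_ar'. Qed.
Lemma cut_a'r' : a' r' = r'. Proof. by rewrite permM tpermR. Qed.
Lemma cut_a'E y : y != r -> y != r' -> a' y = a y.
Proof. by move=> yr yr'; rewrite permM tpermD // eq_sym. Qed.
Lemma cut_s'x : s' x = x. Proof. by rewrite permM tpermR. Qed.
Lemma cut_a'x : a' x = x.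
Proof. by rewrite cut_a'E ?(pl_ax P) 1?eq_sym ?cut_rx ?cut_r'x. Qed.
Lemma cut_a'inv y : a' (a' y) = y.
Proof.
have [->|yr] := eqVneq y r; first by rewrite !cut_a'r.
have [->|yr'] := eqVneq y r'; first by rewrite !cut_a'r'.
have ne u : a' u = u -> y != u -> a' y != u.
  by move=> au yu; rewrite -[X in _ != X]au (inj_eq perm_inj).
by rewrite cut_a'E ?ne ?cut_a'r ?cut_a'r' // cut_a'E // (pl_inv P).
Qed.
Lemma cut_a'fix y : y \in S -> y != x -> y != r -> y != r' -> a' y != y.
Proof. by move=> yS yx yr yr'; rewrite cut_a'E // (pl_afix P). Qed.
Lemma cut_a'on : perm_on S a'.
Proof. by rewrite perm_onM ?perm_on_tperm ?cut_rS ?cut_r'S ?(pl_ona P). Qed.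
Lemma cut_s'on : perm_on S s'.
Proof. by rewrite perm_onM ?perm_on_tperm ?cut_rS ?(pl_root P) ?(pl_ons P). Qed.
Lemma cut_aE : a = (tperm r r' * a')%g. Proof. by rewrite /a' tpermKg. Qed.
Lemma cut_sE : s = (s' * tperm x r)%g. Proof. by rewrite /s' mulg_tpermK. Qed.
Lemma cut_lena : plen a = (plen a').+1.
Proof. by rewrite {1}cut_aE plen_fix ?cut_a'r' ?cut_rr'. Qed.
Lemma cut_lens : plen s = (plen s').+1.
Proof. by rewrite {1}cut_sE plen_ins ?cut_s'x ?cut_rx. Qed.
Lemma cut_psix : psi x = x. Proof. by rewrite permM cut_phix tpermR. Qed.
Lemma cut_lenphi : plen phi = (plen psi).+1.
Proof.
by rewrite -(@plen_del _ phi x) cut_phix ?cut_rx.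
Qed.
Lemma cut_psi w : w != x -> porbit psi w = porbit phi w :\ x.
Proof. by rewrite /psi -cut_phix; apply: porbit_del. Qed.
Lemma cut_psir : porbit psi r = porbit phi x :\ x.
Proof. by rewrite cut_psi ?cut_rx // -cut_phix porbit_perm1. Qed.
Lemma cut_psi_card : #|porbit psi r| = p.
Proof.
have := cardsD1 x (porbit phi x); rewrite porbit_id -cut_psir (pl_ext P).
by case.
Qed.
Lemma cut_psi_tri y : y \in S -> y != x -> y \notin porbit psi r ->
  #|porbit psi y| = 3.
Proof.
move=> yS yx yr; have yphi : y \notin porbit phi x.
  by move: yr; rewrite cut_psir !inE yx.
rewrite cut_psi // -(pl_tri P yS yphi) [in RHS](cardsD1 x).
by rewrite porbit_sym (negbTE yphi).
Qed.
Lemma cut_stable A : x \in A -> r \in A -> r' \in A -> stable a' A ->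
  stable s' A -> ~: S \subset A -> S \subset A.
Proof.
move=> xA rA r'A aA sA SA; apply/subsetP => z _.
move/generatesP: (pl_gen P); apply.
- by rewrite subUset sub1set xA.
- by rewrite cut_aE stableM // stable_tperm.
by rewrite cut_sE stableM // stable_tperm.
Qed.
Lemma cut_cardS : #|S| = (#|S :\ x|).+1.
Proof. by rewrite (cardsD1 x) (pl_root P). Qed.

(** The external face is split here, so cutting lowers the total length by four. A connected planar
    remainder on the darts other than [x] would allow only a loss of two. *)
Lemma cut2 : r' \in porbit phi x -> exists C D i j a1 s1 r1 a2 s2 r2,
  [/\ is_planted C i a1 s1 r1, is_planted D j a2 s2 r2,
      [disjoint C & D], (x \notin C) && (x \notin D) & S = x |: (C :|: D)] /\
  [/\ a = tperm r2 r1 * (a1 * a2), s = s1 * s2 * tperm x r2 & p = (i + j).+2]%g.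
Proof.
move=> r'x; have r'psi : r' \in porbit psi r by rewrite cut_psir !inE cut_r'x.
have lenphi' : plen phi = (plen phi').+2.
  by rewrite cut_lenphi cut_phi'E plen_split ?cut_rr'.
pose C := gen_closure a' s' [set r']; pose D := gen_closure a' s' [set r].
have [aC sC] := gen_closure_stable a' s' [set r'].
have [aD sD] := gen_closure_stable a' s' [set r].
rewrite -/C -/D in aC sC aD sD.
have r'C : r' \in C by apply: mem_gen_closure1.
have rD : r \in D by apply: mem_gen_closure1.
have st0 : stable a' [set~ x] /\ stable s' [set~ x].
  by split; apply/stableC/stable1; rewrite ?cut_a'x ?cut_s'x.
have xC : x \notin C.
  suff /subsetP sub : C \subset [set~ x] by apply/negP => /sub; rewrite !inE eqxx.
  by apply: gen_closure1_sub; rewrite ?inE ?cut_r'x //; case: st0.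
have xD : x \notin D.
  suff /subsetP sub : D \subset [set~ x] by apply/negP => /sub; rewrite !inE eqxx.
  by apply: gen_closure1_sub; rewrite ?inE ?cut_rx //; case: st0.
have [aS sS] := (perm_on_stable cut_a'on, perm_on_stable cut_s'on).
have CS : C \subset S by apply: gen_closure1_sub; rewrite ?cut_r'S.
have DS : D \subset S by apply: gen_closure1_sub; rewrite ?cut_rS.
have SE : S = x |: (C :|: D).
  apply/eqP; rewrite eqEsubset !subUset sub1set (pl_root P) CS DS /= andbT.
  suff /subsetP sub : S \subset (x |: (C :|: D)) :|: ~: S.
    by apply/subsetP => z zS; have := sub z zS; rewrite in_setU [z \in ~: S]inE zS orbF.
  apply: cut_stable; rewrite ?inE ?eqxx ?r'C ?rD ?orbT //; last exact: subsetUr.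
    by rewrite !(stableU, stable1, stableC) // cut_a'x.
  by rewrite !(stableU, stable1, stableC) // cut_s'x.
have len : plen a' + plen s' + plen phi' + 4 = 2 * #|S|.-1.
  by rewrite -(pl_len P) -/phi lenphi' cut_lena cut_lens; clear; lia.
(* If the components met, they would coincide and fill [S :\ x]. The genus inequality would then
   demand a total length of at least [2 * #|S :\ x| - 2], but [len] leaves only
   [2 * #|S :\ x| - 4]. *)
have dCD : [disjoint C & D].
  apply/pred0P => z /=; apply/negP => /andP[zC zD].
  have rC : r \in C.
    apply/negPn/negP => rC.
    have /subsetP/(_ z zD) : D \subset ~: C.
      by apply: gen_closure1_sub; rewrite ?inE //; apply: stableC.
    by rewrite inE zC.
  have DC : D \subset C by apply: gen_closure1_sub.
  have SC : S :\ x = C.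
    rewrite SE (setUidPl DC); apply/setP => w; rewrite !inE.
    by have [->|//] := eqVneq w x; rewrite (negbTE xC).
  suff : generates a' s' (r' |: ~: (S :\ x)).
    move/genus_ge0; have := cardsC (S :\ x).
    have := leq_b1 (r' \notin ~: (S :\ x)).
    by rewrite cardsU1 -/phi'; move: len; rewrite cut_cardS; clear; lia.
  apply/generatesP => A; rewrite subUset sub1set SC => /andP[r'A CA] aA sA w.
  have [wC|wC] := boolP (w \in C); last by apply: (subsetP CA); rewrite inE.
  by move: w wC; apply/subsetP; apply: gen_closure1_sub.
pose a1 := restr_perm C a'; pose s1 := restr_perm C s'.
pose a2 := restr_perm D a'; pose s2 := restr_perm D s'.
have on : [/\ perm_on C a1, perm_on C s1, perm_on D a2 & perm_on D s2].
  by split; apply: restr_perm_on.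
have [aC1 sC1 aD2 sD2] := on.
have split_perm t t1 t2 : perm_on C t1 -> perm_on D t2 -> {in C, t1 =1 t} ->
    {in D, t2 =1 t} -> perm_on S t -> t x = x -> t = (t1 * t2)%g.
  move=> Ct1 Dt2 e1 e2 St tx; apply/permP => z.
  have [zC|zC] := boolP (z \in C); first by rewrite (disj_permL dCD Ct1 Dt2) ?e1.
  have [zD|zD] := boolP (z \in D); first by rewrite (disj_permR dCD _ Ct1) ?e2.
  rewrite (disj_perm_out Ct1 Dt2) //; have [->//|zx] := eqVneq z x.
  by rewrite (out_perm St) // SE !inE (negbTE zx) (negbTE zC).
have aE : a' = (a1 * a2)%g.
  by apply: split_perm => //; [exact: restrE|exact: restrE|exact: cut_a'on|exact: cut_a'x].
have sE : s' = (s1 * s2)%g.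
  by apply: split_perm => //; [exact: restrE|exact: restrE|exact: cut_s'on|exact: cut_s'x].
have phiE : phi' = ((a1 * s1) * (a2 * s2))%g.
  rewrite /phi' aE sE !permA -[(a2 * (s1 * s2))%g]permA.
  by rewrite -(disj_permC dCD sC1 aD2) permA.
have lenC : 2 * #|C|.-1 <= plen a1 + plen s1 + plen (a1 * s1) by apply: component_len.
have lenD : 2 * #|D|.-1 <= plen a2 + plen s2 + plen (a2 * s2) by apply: component_len.
have cardS : #|S| = (#|C| + #|D|).+1.
  by rewrite SE cardsU1 !inE negb_or xC xD cardsU disjoint_setI0 ?cards0 ?subn0.
(* The total equals the sum of the two lower bounds [lenC] and [lenD], so each of them is
   attained. *)
have lenE : plen a1 + plen s1 + plen (a1 * s1) + (plen a2 + plen s2 + plen (a2 * s2))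
    = 2 * #|C|.-1 + 2 * #|D|.-1.
  move: len; rewrite phiE aE sE (plen_disj dCD aC1 aD2) (plen_disj dCD sC1 sD2).
  rewrite (plen_disj dCD (perm_onM aC1 sC1) (perm_onM aD2 sD2)) cardS.
  have : 0 < #|C| by apply/card_gt0P; exists r'.
  have : 0 < #|D| by apply/card_gt0P; exists r.
  clear; lia.
have psirE : porbit psi r = porbit phi' r :|: porbit phi' r'.
  by rewrite cut_phi'E -porbit_tperm_split ?cut_rr'.
have tri y : y \in S -> y != x -> y \notin porbit phi' r -> y \notin porbit phi' r' ->
    #|porbit phi' y| = 3.
  move=> yS yx y1 y2; have yr : y \notin porbit psi r by rewrite psirE inE negb_or y1.
  rewrite cut_phi'E porbit_tperm_other ?cut_psi_tri // porbit_sym //.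
  by rewrite (porbit_eq r'psi).
have phiC : porbit phi' r' \subset C by rewrite porbit_sub // stableM.
have phiD : porbit phi' r \subset D by rewrite porbit_sub // stableM.
(* The root dart [r] belongs to the second piece, in agreement with [glue2_sx]; the predecessors
   discount the half-edges. *)
exists C, D, #|porbit phi' r'|.-1, #|porbit phi' r|.-1, a1, s1, r', a2, s2, r.
split; split; rewrite ?xC ?xD -?aE -?sE -?cut_aE -?cut_sE //.
- apply: component_planted.
  + exact: cut_a'r'.
  + exact: cut_a'inv.
  + move=> y yC yr'; apply: cut_a'fix => //; first exact: (subsetP CS).
      by apply: contraNneq xC => <-.
    by apply: contraTneq yC => ->; rewrite (disjR dCD).
  + move=> y yC yr'; apply: tri => //; first exact: (subsetP CS).
      by apply: contraNneq xC => <-.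
    by apply: contraTN yC => /(subsetP phiD); apply: disjR.
  move: lenC lenD lenE; rewrite -/C -/a1 -/s1; clear; lia.
- apply: component_planted.
  + exact: cut_a'r.
  + exact: cut_a'inv.
  + move=> y yD yr; apply: cut_a'fix => //; first exact: (subsetP DS).
      by apply: contraNneq xD => <-.
    by apply: contraTneq yD => ->; rewrite (disjL dCD).
  + move=> y yD yr; apply: tri => //; first exact: (subsetP DS).
      by apply: contraNneq xD => <-.
    by apply: contraTN yD => /(subsetP phiC); apply: disjL.
  move: lenC lenD lenE; rewrite -/D -/a2 -/s2; clear; lia.
have := card_porbit_tperm_split r'psi cut_rr'; rewrite -cut_phi'E cut_psi_card.
have := card_porbit_neq0 phi' r; have := card_porbit_neq0 phi' r'.
clear; lia.
Qed.

(** Here [r'] lies on an inner triangle, which the cut merges with the external face. The dart [r]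
    stays as the half-edge of the smaller map, and [r'] is discarded by bypassing it in the
    rotation, where its successor is [q]. Walking along the two remaining sides of the triangle
    leads from [r] to [q], so the place of [r'] can be found again in the smaller map. *)
Lemma cut1 (q := psi r) (s0 := (s' * tperm r' q)%g) (phi0 := (a' * s0)%g) :
  r' \notin porbit phi x ->
  [/\ is_planted (S :\ x :\ r') p.+1 a' s0 r, 0 < p
    & phi0 (phi0 (phi0 r)) = q].
Proof.
move=> r'x; have r'psi : r' \notin porbit psi r.
  by rewrite cut_psir !inE (negbTE r'x) andbF.
have psi3 : #|porbit psi r'| = 3 by rewrite cut_psi_tri ?cut_r'S ?cut_r'x.
have [p3 p1 p2 p12] := porbit3 psi3.
have qr' : q != r'.
  by apply: contraNneq r'psi => <-; rewrite -porbit_perm1 porbit_id.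
have phi'r' : phi' r' = q by rewrite cut_phi'E permM tpermR.
have s'r' : s' r' = q by rewrite -phi'r' [phi' r']permM cut_a'r'.
have s0E : s0 = (s' * tperm r' (s' r'))%g by rewrite s'r'.
have phi0E : phi0 = (phi' * tperm r' (phi' r'))%g by rewrite phi'r' /phi0 /s0 /phi' permA.
have lenphi' : plen phi' = plen phi by rewrite cut_lenphi cut_phi'E plen_merge.
have phi'r : porbit phi' r = porbit psi r :|: porbit psi r'.
  by rewrite cut_phi'E porbit_tperm_merge.
have phi0_porb w : w != r' -> porbit phi0 w = porbit phi' w :\ r'.
  by rewrite phi0E; apply: porbit_del.
have p_gt0 : 0 < p by rewrite -cut_psi_card; apply/card_gt0P; exists r; apply: porbit_id.
set b1 := psi r' in p3 p1 p2 p12; set b2 := psi b1 in p3 p2 p12.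
have inr' : b1 \in porbit psi r' /\ b2 \in porbit psi r'.
  by rewrite /b2 /b1 -!(porbit_sym _ r') !porbit_perm1 porbit_id.
have neqr w : w \in porbit psi r' -> r != w.
  by move=> wr; apply: contraNneq r'psi => ->; rewrite porbit_sym.
have neqq w : w \in porbit psi r' -> q != w.
  by move=> wr; apply: contraNneq r'psi => e; rewrite -porbit_perm1 -/q e porbit_sym.
have phi0r : phi0 r = b1.
  rewrite phi0E phi'r' permM cut_phi'E permM tpermL tpermD ?neqq //; last by case: inr'.
  by rewrite eq_sym.
have phi0b1 : phi0 b1 = b2.
  rewrite phi0E phi'r' permM cut_phi'E permM (tpermD (z := b1)) ?neqr //; [|by case: inr'|by rewrite eq_sym].
  by rewrite tpermD ?neqq // 1?eq_sym //; case: inr'.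
have phi0b2 : phi0 b2 = q.
  rewrite phi0E phi'r' permM cut_phi'E permM (tpermD (z := b2)) ?neqr //; [|by case: inr'|by rewrite eq_sym].
  by rewrite p3 tpermL.
split => //; last by rewrite phi0r phi0b1 phi0b2.
set S0 := S :\ x :\ r'.
have S0S y : y \in S0 -> [/\ y \in S, y != x & y != r'].
  by rewrite !inE => /and3P[-> -> ->].
have rS0 : r \in S0 by rewrite !inE cut_rS cut_rx cut_rr'.
have onS0 t : perm_on S t -> t x = x -> t r' = r' -> perm_on S0 t.
  move=> St tx tr'; apply/subsetP => y; rewrite inE => ty; rewrite !inE.
  have -> : y \in S by apply: contraNT ty => /(out_perm St)->.
  by rewrite andbT; apply/andP; split; apply: contraNneq ty => ->; apply/eqP.
have xr' : x != r' by rewrite eq_sym cut_r'x.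
have qx : q != x.
  have : r \in porbit psi q by rewrite porbit_perm1 porbit_id.
  by apply: contraTneq => ->; rewrite porbit_fix ?cut_psix // inE cut_rx.
have qS : q \in S by rewrite -s'r' (perm_closed _ cut_s'on) cut_r'S.
have s0x : s0 x = x by rewrite permM cut_s'x tpermD // eq_sym.
have s0r' : s0 r' = r' by rewrite permM s'r' tpermR.
have s0S : perm_on S s0 by rewrite perm_onM ?cut_s'on // perm_on_tperm ?cut_r'S.
have s'E : s' = (s0 * tperm r' q)%g by rewrite /s0 mulg_tpermK.
split => //.
- by rewrite onS0 ?cut_a'on ?cut_a'x ?cut_a'r'.
- exact: onS0.
- exact: cut_a'r.
- by move=> y /S0S[yS yx yr'] yr; apply: cut_a'fix.
- exact: cut_a'inv.
- apply/generatesP => A; rewrite subUset sub1set => /andP[rA SA] aA sA z.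
  have cA w : w \notin S0 -> w \in A by move=> wS; apply: (subsetP SA); rewrite inE.
  have xA : x \in A by rewrite cA // !inE eqxx andbF.
  have r'A : r' \in A by rewrite cA // !inE eqxx.
  have qA : q \in A by rewrite -phi0b2 -phi0b1 -phi0r !(stableE _ (stableM aA sA)).
  have SA' : ~: S \subset A.
    by apply/subsetP => w; rewrite inE => wS; rewrite cA //; apply: contra wS => /S0S[].
  have [zS|zS] := boolP (z \in S); last by apply: (subsetP SA'); rewrite inE.
  apply: (subsetP (cut_stable xA rA r'A aA _ SA')) zS.
  by rewrite s'E stableM // stable_tperm.
- have l1 : (plen phi0).+1 = plen phi' by rewrite phi0E plen_del // phi'r'.
  have l2 : (plen s0).+1 = plen s' by rewrite s0E plen_del // s'r'.
  have := pl_len P; rewrite -/phi -lenphi' -l1 cut_lena cut_lens -l2 cut_cardS.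
  rewrite (cardsD1 r' (S :\ x)) !inE cut_r'S cut_r'x -/S0 -/phi0.
  have : 0 < #|S0| by apply/card_gt0P; exists r.
  clear; lia.
(* The merged face has [p + 3] darts; without [r'], and without counting the half-edge [r], its
   degree is [p + 1]. *)
- have := card_porbit_tperm_merge r'psi; rewrite -cut_phi'E cut_psi_card psi3 -/phi0.
  rewrite phi0_porb ?cut_rr' // (cardsD1 r' (porbit phi' r)) phi'r inE porbit_id orbT.
  clear; lia.
move=> y /S0S[yS yx yr']; rewrite -/phi0 !phi0_porb ?cut_rr' // !inE yr' /= phi'r.
rewrite inE negb_or => /andP[y1 y2].
have phi'y : porbit phi' y = porbit psi y.
  by rewrite cut_phi'E porbit_tperm_other // porbit_sym.
rewrite phi'y -(cut_psi_tri yS yx y1) [in RHS](cardsD1 r').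
by rewrite porbit_sym (negbTE y2).
Qed.

End Cut.

(* The edge from [r] to [r'] closes a triangle on the first two sides of the
   external face of a planted map with half-edge [r]; [x] is the half-edge of the
   result, and [q] the dart that follows these two sides. *)
Section Glue1.
Variables (S0 : {set U}) (p : nat) (a' s0 : {perm U}) (r r' x : U).
Hypotheses (P : is_planted S0 p.+1 a' s0 r) (p_gt0 : 0 < p).
Hypotheses (xr' : x != r') (xS0 : x \notin S0) (r'S0 : r' \notin S0).
Let phi0 : {perm U} := (a' * s0)%g.
Let q := phi0 (phi0 (phi0 r)).
Let s' : {perm U} := (s0 * tperm r' q)%g.
Let a : {perm U} := (tperm r r' * a')%g.
Let s : {perm U} := (s' * tperm x r)%g.
Let S := x |: (r' |: S0).

Let rS0 : r \in S0 := pl_root P.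
Let rr' : r != r'. Proof. by apply: contraNneq r'S0 => <-. Qed.
Let rx : r != x. Proof. by apply: contraNneq xS0 => <-. Qed.
Let phi0S : perm_on S0 phi0. Proof. exact: perm_onM (pl_ona P) (pl_ons P). Qed.
Let qS0 : q \in S0. Proof. by rewrite !(perm_closed _ phi0S). Qed.
Let qr' : q != r'. Proof. by apply: contraNneq r'S0 => <-. Qed.
Let qx : q != x. Proof. by apply: contraNneq xS0 => <-. Qed.
Let outa z : z \notin S0 -> a' z = z := out_perm (pl_ona P) (x := z).
Let outs z : z \notin S0 -> s0 z = z := out_perm (pl_ons P) (x := z).
Let s'x : s' x = x.
Proof. by rewrite permM outs // tpermD // eq_sym. Qed.
Let a'x : a' x = x. Proof. exact: outa. Qed.
Let a'r' : a' r' = r'. Proof. exact: outa. Qed.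
Let s'r' : s' r' = q. Proof. by rewrite permM outs // tpermL. Qed.

Lemma glue1_sx : s x = r. Proof. by rewrite /s permM s'x tpermL. Qed.
Lemma glue1_ar : a r = r'. Proof. by rewrite /a permM tpermL a'r'. Qed.
Lemma glue1_card : #|S| = #|S0|.+2.
Proof. by rewrite /S !cardsU1 !inE negb_or xr' xS0 r'S0. Qed.

Let phi' : {perm U} := (a' * s')%g.
Let psi : {perm U} := (tperm r r' * phi')%g.
Let phi : {perm U} := (a * s)%g.
Let phiE : phi = (psi * tperm x r)%g. Proof. by rewrite /phi /a /s /psi /phi' !permA. Qed.
Let phi'E : phi' = (phi0 * tperm r' q)%g. Proof. by rewrite /phi' /s' /phi0 permA. Qed.
Let phi'r' : phi' r' = q. Proof. by rewrite permM a'r' s'r'. Qed.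
Let phi0E : phi0 = (phi' * tperm r' (phi' r'))%g.
Proof. by rewrite phi'r' phi'E mulg_tpermK. Qed.
Let phi0r' : phi0 r' = r'. Proof. by rewrite permM a'r' outs. Qed.
Let phi0_porb w : w != r' -> porbit phi0 w = porbit phi' w :\ r'.
Proof. by rewrite phi0E; apply: porbit_del. Qed.
Let psix : psi x = x. Proof. by rewrite permM tpermD // 1?eq_sym // permM a'x s'x. Qed.
Let phix : phi x = r. Proof. by rewrite phiE permM psix tpermL. Qed.
Let psiE : psi = (phi * tperm x (phi x))%g.
Proof. by rewrite phix phiE mulg_tpermK. Qed.
Let psi_porb w : w != x -> porbit psi w = porbit phi w :\ x.
Proof. by rewrite psiE; apply: porbit_del. Qed.
Let b1 := phi0 r.
Let b2 := phi0 b1.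
(** The place where [0 < p] enters: the external face of the smaller map has [p.+2 >= 3] darts,
    half-edge included. For [p = 1] they are just these three, and [q = r]. *)
Let uniq_b : [/\ b1 != r, b2 != r & b2 != b1].
Proof.
have := uniq_traject_porbit phi0 r; rewrite (pl_ext P) -/phi0.
case: p p_gt0 => // k _; rewrite /= -/b1 -/b2 !inE !negb_or !(eq_sym _ b2) (eq_sym r b1).
by move=> /andP[/and3P[-> -> _] /andP[/andP[-> _] _]].
Qed.
Let b1S0 : b1 \in S0. Proof. by rewrite (perm_closed _ phi0S). Qed.
Let b2S0 : b2 \in S0. Proof. by rewrite (perm_closed _ phi0S). Qed.
Let neS0 w : w \in S0 -> r' != w.
Proof. by move=> wS; apply: contraNneq r'S0 => ->. Qed.
Let psir' : psi r' = b1.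
Proof.
rewrite permM tpermR phi'E permM tpermD ?neS0 //.
case: uniq_b => _ h _; apply: contraNneq h => e.
by apply/eqP/(@perm_inj _ phi0); apply: e.
Qed.
Let psib1 : psi b1 = b2.
Proof.
case: uniq_b => h1 h2 h3.
rewrite permM tpermD ?neS0 //; last by rewrite eq_sym.
rewrite phi'E permM tpermD ?neS0 //.
by apply: contraNneq h3 => e; apply/eqP/(@perm_inj _ phi0).
Qed.
Let psib2 : psi b2 = r'.
Proof.
case: uniq_b => h1 h2 h3; rewrite permM tpermD ?neS0 //; last by rewrite eq_sym.
by rewrite phi'E permM -/q tpermR.
Qed.
Let psi_r' : porbit psi r' = [set r'; b1; b2].
Proof.
apply/eqP; rewrite eqEsubset; apply/andP; split.
  apply: porbit_sub; last by rewrite !inE eqxx.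
  apply/stableP => w; rewrite !inE => /orP[/orP[]|] /eqP->;
  by rewrite ?psir' ?psib1 ?psib2 eqxx ?orbT.
rewrite !subUset !sub1set porbit_id /= !(porbit_sym psi _ r').
by rewrite -psib1 -psir' !porbit_perm1 porbit_id.
Qed.
Let psi3 : #|porbit psi r'| = 3.
Proof.
case: uniq_b => h1 h2 h3; rewrite psi_r' setUC !cardsU1 cards1 !inE negb_or.
by rewrite h3 !(eq_sym _ r') !neS0.
Qed.
Let r_psi : r \notin porbit psi r'.
Proof.
by case: uniq_b => h1 h2 h3; rewrite psi_r' !inE !negb_or !(eq_sym r) h1 h2 eq_sym rr'.
Qed.
Let r'_psi : r' \notin porbit psi r. Proof. by rewrite porbit_sym. Qed.
Let phi'psi : phi' = (tperm r r' * psi)%g. Proof. by rewrite /psi tpermKg. Qed.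
Let phi'r : porbit phi' r = porbit psi r :|: porbit psi r'.
Proof. by rewrite phi'psi porbit_tperm_merge. Qed.
Let psi_r : porbit psi r = porbit phi x :\ x.
Proof. by rewrite psi_porb // -phix porbit_perm1. Qed.

Lemma glue1_case : a (s x) \notin porbit (a * s) x.
Proof.
rewrite glue1_sx glue1_ar -/phi; apply: contra r'_psi.
by rewrite psi_r !inE => ->; rewrite eq_sym xr'.
Qed.

Lemma glue1_s'r' : s' r' = q. Proof. exact: s'r'. Qed.

Lemma glue1_planted : is_planted S p a s x.
Proof.
have S0S : S0 \subset S by rewrite /S setUA subsetUr.
have xS : x \in S by rewrite !inE eqxx.
have r'S : r' \in S by rewrite !inE eqxx orbT.
have rS : r \in S := subsetP S0S _ rS0.
have aE y : y != r -> y != r' -> a y = a' y.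
  by move=> y1 y2; rewrite permM tpermD // eq_sym.
have ar' : a r' = r by rewrite permM tpermR (pl_ax P).
have aS : perm_on S a by rewrite perm_onM ?perm_on_tperm // (perm_onS S0S (pl_ona P)).
have sS : perm_on S s.
  by rewrite !perm_onM ?perm_on_tperm ?(perm_onS S0S (pl_ons P)) // (subsetP S0S).
have lenphi' : plen phi' = (plen psi).+1 by rewrite phi'psi plen_merge.
split => //.
- by rewrite aE // eq_sym.
- move=> y; have [->|y1] := eqVneq y r; first by rewrite glue1_ar [r' == _]eq_sym.
  have [->|y2] := eqVneq y r'; first by rewrite ar'.
  rewrite !inE aE // (negbTE y2) /= => /orP[->//|yS0 _]; exact: (pl_afix P).
- move=> y; have [->|y1] := eqVneq y r; first by rewrite glue1_ar ar'.
  have [->|y2] := eqVneq y r'; first by rewrite ar' glue1_ar.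
  have ne u : a' u = u -> y != u -> a' y != u.
    by move=> au yu; rewrite -[X in _ != X]au (inj_eq perm_inj).
  by rewrite (aE y) // aE ?(pl_inv P) // ne // (pl_ax P).
- apply/generatesP => A; rewrite subUset sub1set => /andP[xA SA] aA sA z.
  have rA : r \in A by rewrite -glue1_sx stableE.
  have r'A : r' \in A by rewrite -glue1_ar stableE.
  have a'A : stable a' A by rewrite -[a'](tpermKg r r') stableM // stable_tperm.
  have s'A : stable s' A.
    have -> : s' = (s * tperm x r)%g by rewrite /s mulg_tpermK.
    by rewrite stableM // stable_tperm.
  have qA : q \in A by rewrite -s'r' stableE.
  have s0A : stable s0 A.
    have -> : s0 = (s' * tperm r' q)%g by rewrite /s' mulg_tpermK.
    by rewrite stableM // stable_tperm.
  move/generatesP: (pl_gen P); apply => //; rewrite subUset sub1set rA /=.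
  apply/subsetP => w; rewrite inE => wS0; have [->//|wx] := eqVneq w x.
  have [->//|wr'] := eqVneq w r'; apply: (subsetP SA).
  by rewrite !inE (negbTE wx) (negbTE wr').
- have l1 : plen phi = plen phi'.
    by rewrite lenphi' phiE plen_ins.
  have l2 : plen phi' = (plen phi0).+1 by rewrite phi'E plen_ins.
  have l3 : plen s = (plen s0).+2 by rewrite /s plen_ins // /s' plen_ins // outs.
  have l4 : plen a = (plen a').+1 by rewrite /a plen_fix.
  have := pl_len P; rewrite -/phi0 -/phi l1 l2 l3 l4 glue1_card.
  have : 0 < #|S0| by apply/card_gt0P; exists r.
  clear; lia.
- rewrite -/phi (cardsD1 x) porbit_id -psi_r.
  have := card_porbit_tperm_merge r'_psi; rewrite -phi'psi psi3.
  have := pl_ext P; rewrite -/phi0 phi0_porb //.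
  rewrite (cardsD1 r' (porbit phi' r)) phi'r inE porbit_id orbT.
  clear; lia.
move=> y yS; rewrite -/phi => yx'.
have yx : y != x by apply: contraNneq yx' => ->; apply: porbit_id.
have xy : x \notin porbit phi y by rewrite porbit_sym.
have -> : porbit phi y = porbit psi y.
  rewrite psi_porb //; apply/setP => w; rewrite !inE.
  by have [->|//] := eqVneq w x; apply: negbTE.
have y1 : y \notin porbit psi r by rewrite psi_r !inE yx.
have [/porbit_eq->//|y2] := boolP (y \in porbit psi r').
have phi'y : porbit phi' y = porbit psi y.
  by rewrite phi'psi porbit_tperm_other // porbit_sym.
have yr' : y != r' by apply: contraNneq y2 => ->; apply: porbit_id.
have -> : porbit psi y = porbit phi0 y.
  rewrite phi0_porb // phi'y; apply/setP => w; rewrite !inE.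
  by have [->|//] := eqVneq w r'; apply: contraNF y2; rewrite porbit_sym.
apply: (pl_tri P).
  by move: yS; rewrite !inE (negbTE yx) (negbTE yr').
by rewrite -/phi0 phi0_porb // !inE yr' phi'r inE negb_or y1.
Qed.
End Glue1.

(** The result determines [r] as [s x], [r'] as [a r], and then the edge involution. The rotation
    with [x] removed sends [r'] to [q], so [q] is known before the rotation of the smaller map, and
    bypassing [r'] recovers the latter. *)
Lemma glue1_inj S0 p a0 s0 r r' x S1 p1 a1 s1 r1 r1' :
  is_planted S0 p.+1 a0 s0 r -> x \notin S0 -> r' \notin S0 -> x != r' ->
  is_planted S1 p1.+1 a1 s1 r1 -> x \notin S1 -> r1' \notin S1 -> x != r1' ->
  let q := iter 3 (a0 * s0)%g r in let q1 := iter 3 (a1 * s1)%g r1 in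
  (tperm r r' * a0 = tperm r1 r1' * a1)%g ->
  (s0 * tperm r' q * tperm x r = s1 * tperm r1' q1 * tperm x r1)%g ->
  (r', (a0, s0, r)) = (r1', (a1, s1, r1)).
Proof.
move=> P0 x0 r'0 xr' P1 x1 r'1 xr1' /= ea es.
have er : r = r1.
  by rewrite -(glue1_sx P0 xr' x0) -(glue1_sx P1 xr1' x1) es.
have er' : r' = r1'.
  by rewrite -(glue1_ar P0 r'0) -(glue1_ar P1 r'1) ea er.
move: P1 x1 r'1 xr1' ea es; rewrite -er -er' => P1 x1 r'1 xr1' /mulgI ea.
move: P1; rewrite -ea => P1 /mulIg es.
have /= eq := glue1_s'r' P0 r'0; have /= := glue1_s'r' P1 r'1.
by rewrite -es eq => e; move: es; rewrite e => /mulIg <-.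
Qed.

End Cut2.

(** * Counting planted maps *)

Lemma card_dep (T1 T2 : finType) (P : pred T1) (Q : T1 -> {set T2}) :
  #|[set t : T1 * T2 | P t.1 & t.2 \in Q t.1]| = \sum_(x | P x) #|Q x|.
Proof.
rewrite -sum1dep_card (eq_bigr (fun x => \sum_(y in Q x) 1)) => [|x _]; last first.
  by rewrite sum1_card.
by rewrite pair_big_dep.
Qed.

Section Count.
Variable U : finType.
Implicit Types (s t a : {perm U}) (x y z w r : U) (A B S R C D : {set U}).

Definition planted_set S p : {set rooted_map U} := [set M | planted S p M].

Definition glue1 (t : U * (U * rooted_map U)) : rooted_map U :=
  let: (x, (r', (a', s0, r))) := t in
  (tperm r r' * a', s0 * tperm r' (iter 3 (a' * s0) r) * tperm x r, x)%g.

Definition dom1_at S p x : {set U * rooted_map U} :=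
  [set u | u.1 \in S :\ x & u.2 \in planted_set (S :\ x :\ u.1) p.+1].

Definition dom1 S p : {set U * (U * rooted_map U)} :=
  [set t | t.1 \in S & t.2 \in dom1_at S p t.1].

Lemma card_dom1 S p : #|dom1 S p| =
  \sum_(x in S) \sum_(y in S :\ x) #|planted_set (S :\ x :\ y) p.+1|.
Proof.
apply: etrans (card_dep (fun x => x \in S) (dom1_at S p)) _; apply: eq_bigr => x _.
exact: (card_dep (fun y => y \in S :\ x) (fun y => planted_set (S :\ x :\ y) p.+1)).
Qed.

(** [k] stands for [p.-1]: the boundary lengths [i] and [k.-1 - i] of the pieces add up to [p - 2],
    and there is no term for [p <= 1]. *)
Definition glue2 k (t : U * ({set U} * ('I_k * (rooted_map U * rooted_map U)))) :
    rooted_map U :=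
  let: (x, (C, (i, ((a1, s1, r1), (a2, s2, r2))))) := t in
  (tperm r2 r1 * (a1 * a2), s1 * s2 * tperm x r2, x)%g.

Definition dom2_pair S k x C (i : 'I_k) : {set rooted_map U * rooted_map U} :=
  setX (planted_set C i) (planted_set (S :\ x :\: C) (k.-1 - i)).

Definition dom2_at S k x : {set {set U} * ('I_k * (rooted_map U * rooted_map U))} :=
  [set u : {set U} * ('I_k * (rooted_map U * rooted_map U)) | u.1 \subset S :\ x &
     u.2 \in [set v : 'I_k * (rooted_map U * rooted_map U) | true & v.2 \in dom2_pair S x u.1 v.1]].

Definition dom2 S k : {set U * ({set U} * ('I_k * (rooted_map U * rooted_map U)))} :=
  [set t | t.1 \in S & t.2 \in dom2_at S k t.1].

Lemma card_dom2 S k : #|dom2 S k| = \sum_(x in S) \sum_(C : {set U} | C \subset S :\ x)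
  \sum_(i < k) #|planted_set C i| * #|planted_set (S :\ x :\: C) (k.-1 - i)|.
Proof.
apply: etrans (card_dep (fun x => x \in S) (dom2_at S k)) _; apply: eq_bigr => x _.
apply: etrans (card_dep (fun C : {set U} => C \subset S :\ x)
  (fun C => [set v : 'I_k * (rooted_map U * rooted_map U) | true & v.2 \in dom2_pair S x C v.1])) _; apply: eq_bigr => C _.
apply: etrans (card_dep xpredT (fun i : 'I_k => dom2_pair S x C i)) _.
by apply: eq_bigr => i _; apply: cardsX.
Qed.

(** The root edge has the external face on both sides, which in a planar map means that it
    disconnects. The test also succeeds for the single vertex, hence the condition [#|S| != 1] in
    the two image lemmas. *)
Definition bridge (M : rooted_map U) : bool :=
  alpha M (sigma M (Defs.root M)) \in porbit (alpha M * sigma M) (Defs.root M).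

Lemma image_glue1 S p : 0 < p ->
  glue1 @: dom1 S p = [set M in planted_set S p | ~~ bridge M && (#|S| != 1)].
Proof.
move=> p0; apply/setP => -[[a s] x]; rewrite !inE; apply/imsetP/idP.
  case=> -[y [r' [[a' s0] r]]]; rewrite !inE /= => /andP[yS /andP[/andP[r'y r'S]]].
  move=> /plantedP P [-> -> ->].
  have y0 : y \notin S :\ y :\ r' by rewrite !inE eqxx andbF.
  have r'0 : r' \notin S :\ y :\ r' by rewrite !inE eqxx.
  rewrite eq_sym in r'y.
  have SE : S = y |: (r' |: S :\ y :\ r').
    by rewrite setD1K ?setD1K // !inE eq_sym r'y.
  have := glue1_planted P p0 r'y y0 r'0; have := glue1_card r'y y0 r'0.
  rewrite -SE => -> PS; rewrite andbT; apply/andP; split; first exact/plantedP.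
  exact: (glue1_case P).
case/andP=> /plantedP P /andP[nb S1].
have nS1 : S != [set x] by apply: contraNneq S1 => ->; rewrite cards1.
have [P0 _ e] := cut1 P nS1 nb.
exists (x, (a (s x), (tperm (s x) (a (s x)) * a,
   s * tperm x (s x) * tperm (a (s x)) ((a * s * tperm x (s x)) (s x)), s x)))%g.
  rewrite !inE /= (pl_root P) (cut_r'x P nS1) (cut_r'S P) /=.
  exact/plantedP.
rewrite /= e tpermKg; congr (_, _, _).
by rewrite !mulg_tpermK.
Qed.

Lemma glue1_injective S p : {in dom1 S p &, injective glue1}.
Proof.
move=> [x [r' [[a0 s0] r]]] [x1 [r1' [[a1 s1] r1]]]; rewrite !inE /=.
move=> /andP[xS /andP[/andP[r'x r'S] /plantedP P]].
move=> /andP[xS1 /andP[/andP[r'x1 r'S1] /plantedP P']] [ea es ex].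
move: r'x1 r'S1 P' xS1 ea es; rewrite -ex => r'x1 r'S1 P' _ ea es.
congr (_, _); apply: (glue1_inj P _ _ _ P') ea es;
  by rewrite ?inE ?eqxx ?andbF // eq_sym.
Qed.

Lemma image_glue2 S p :
  @glue2 p.-1 @: dom2 S p.-1 = [set M in planted_set S p | bridge M && (#|S| != 1)].
Proof.
apply/setP => -[[a s] x]; rewrite !inE; apply/imsetP/idP.
  case=> -[y [C [i [[[a1 s1] r1] [[a2 s2] r2]]]]]; rewrite !inE /=.
  move=> /andP[yS /andP[CS /andP[/plantedP P1 /plantedP P2]]] [-> -> ->].
  set D := _ :\: C in P2.
  have dCD : [disjoint C & D].
    by rewrite disjoint_sym -setI_eq0 /D setIDAC setDIl setDv setI0 eqxx.
  have yC : y \notin C by apply/negP => /(subsetP CS); rewrite !inE eqxx.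
  have yD : y \notin D by rewrite !inE eqxx andbF.
  have SE : S = y |: (C :|: D).
    apply/setP => z; rewrite !inE; have [->|zy] //= := eqVneq z y.
    by case zC: (z \in C) => //=; have := subsetP CS z zC; rewrite !inE => /andP[].
  have pE : p = (i + (p.-2 - i)).+2 by move: (ltn_ord i); clear; lia.
  have := glue2_planted P1 P2 dCD yC yD; have := glue2_card dCD yC yD.
  rewrite -SE -pE => -> PS; rewrite eqSS.
  have -> : #|C| + #|D| != 0.
    by rewrite addn_eq0 negb_and -!lt0n; apply/orP; left; apply/card_gt0P; exists r1; apply: pl_root P1.
  rewrite andbT; apply/andP; split; first exact/plantedP.
  exact: (glue2_case P1 P2).
case/andP=> /plantedP P /andP[br S1].
have nS1 : S != [set x] by apply: contraNneq S1 => ->; rewrite cards1.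
have [C [D [i [j [a1 [s1 [r1 [a2 [s2 [r2]]]]]]]]]] := cut2 P nS1 br.
case=> -[P1 P2 dCD /andP[xC xD] SE] [aE sE pE].
have lt : i < p.-1 by rewrite pE; clear; lia.
have SD : S :\ x :\: C = D.
  rewrite SE setU1K ?inE ?negb_or ?xC // setDUl setDv set0U.
  by apply/setDidPl; rewrite disjoint_sym.
exists (x, (C, (Ordinal lt, ((a1, s1, r1), (a2, s2, r2))))); last by rewrite /= -aE -sE.
rewrite !inE /= (pl_root P) SD SE setU1K ?inE ?negb_or ?xC // subsetUl /=.
apply/andP; split; first exact/plantedP.
have -> : p.-2 - i = j by rewrite pE; clear; lia.
exact/plantedP.
Qed.

Lemma glue2_injective S k : {in dom2 S k &, injective (@glue2 k)}.
Proof.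
move=> [x [C [i [[[a1 s1] r1] [[a2 s2] r2]]]]] [x' [C' [i' [[[b1 t1] w1] [[b2 t2] w2]]]]].
rewrite !inE /= => /andP[xS /andP[CS /andP[/plantedP P1 /plantedP P2]]].
move=> /andP[xS' /andP[CS' /andP[/plantedP P1' /plantedP P2']]] [ea es ex].
move: xS' CS' P2' ea es; rewrite -ex => xS' CS' P2' ea es.
have dj (E : {set U}) : [disjoint E & S :\ x :\: E].
  by rewrite disjoint_sym -setI_eq0 setIDAC setDIl setDv setI0 eqxx.
have nE (E : {set U}) : E \subset S :\ x -> x \notin E.
  by move=> ES; apply/negP => /(subsetP ES); rewrite !inE eqxx.
have nD (E : {set U}) : x \notin S :\ x :\: E by rewrite !inE eqxx andbF.
have := glue2_inj P1 P2 (dj C) (nE _ CS) (nD C) P1' P2' (dj C') (nE _ CS') (nD C') ea es.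
case=> eC ea1 es1 er1 -> -> ->.
have -> : i = i'.
  by apply/val_inj/succn_inj; rewrite -(pl_ext P1) -(pl_ext P1') /= ea1 es1 er1.
by rewrite eC ea1 es1 er1.
Qed.

(** When there are edges, the root dart lies on the external face next to the half-edge. *)
Lemma planted_set_empty S : 1 < #|S| -> planted_set S 0 = set0.
Proof.
move=> S1; apply/setP => -[[a s] x]; rewrite !inE; apply/negP => /plantedP P.
have nS1 : S != [set x] by apply: contraTneq S1 => ->; rewrite cards1.
have := cut_psi_card P nS1; have := card_porbit_neq0 (a * s * tperm x (s x)) (s x).
by move=> /eqP.
Qed.

(** Tutte's equation for labelled maps: every map with an edge arises from exactly one of the two
    gluings, in exactly one way. *)
Lemma card_planted_rec S p : 1 < #|S| -> 0 < p -> #|planted_set S p| =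
  \sum_(x in S) \sum_(y in S :\ x) #|planted_set (S :\ x :\ y) p.+1| +
  \sum_(x in S) \sum_(C : {set U} | C \subset S :\ x) \sum_(i < p.-1)
     #|planted_set C i| * #|planted_set (S :\ x :\: C) (p.-2 - i)|.
Proof.
move=> S1 p0; rewrite -card_dom1 -card_dom2.
rewrite -(card_in_imset (@glue1_injective S p)) -(card_in_imset (@glue2_injective S p.-1)).
rewrite image_glue1 ?image_glue2 //.
have -> : #|S| != 1 by move: S1; case: #|S| => [|[]].
rewrite -(cardsID [set M | bridge M] (planted_set S p)) addnC; congr (_ + _); apply: eq_card => M.
  by rewrite !inE andbT andbC.
by rewrite !inE andbT.
Qed.

End Count.

(** * From labelled planted maps to rooted maps up to isomorphism *)

Section Push.
Variables (D U : finType) (e : D -> U).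
Hypothesis e_inj : injective e.
Implicit Types (s t : {perm D}) (d : D) (u : U).

(** Transport of a permutation along [e], extended by the identity. It relates maps whose darts form
    a whole type, as in the definition of [num_triangulations_darts], to maps carried by a subset of
    [U]. *)
Definition push_fun s u := if [pick d | e d == u] is Some d then e (s d) else u.

Lemma push_funE s d : push_fun s (e d) = e (s d).
Proof.
rewrite /push_fun; case: pickP => [d' /eqP/e_inj->//|/(_ d)]; by rewrite eqxx.
Qed.

Lemma push_fun_out s u : u \notin e @: [set: D] -> push_fun s u = u.
Proof.
rewrite /push_fun; case: pickP => // d /eqP <- /imsetP[]; by exists d.
Qed.

Lemma push_fun_inj s : injective (push_fun s).
Proof.
apply: (can_inj (g := push_fun s^-1)) => u.
have [/imsetP[d _ ->]|uN] := boolP (u \in e @: [set: D]).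
  by rewrite !push_funE permK.
by rewrite !push_fun_out.
Qed.

Definition push s : {perm U} := perm (@push_fun_inj s).

Lemma pushE s d : push s (e d) = e (s d).
Proof. by rewrite permE push_funE. Qed.

Lemma push_out s u : u \notin e @: [set: D] -> push s u = u.
Proof. by rewrite permE; apply: push_fun_out. Qed.

Lemma push_on s : perm_on (e @: [set: D]) (push s).
Proof.
apply/subsetP => u; rewrite inE; apply: contraNT => /push_out->; exact: eqxx.
Qed.

Lemma eq_push (t : {perm U}) s : perm_on (e @: [set: D]) t ->
  (forall d, t (e d) = e (s d)) -> t = push s.
Proof.
move=> tD te; apply: (eq_perm_on tD (push_on s)) => _ /imsetP[d _ ->].
by rewrite te pushE.
Qed.

Lemma push1 : push 1 = 1%g.
Proof. by apply/esym/eq_push => [|d]; rewrite ?perm_on1 ?perm1. Qed.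

Lemma pushM s t : push (s * t) = (push s * push t)%g.
Proof.
by apply/esym/eq_push => [|d]; rewrite ?perm_onM ?push_on // !permM !pushE.
Qed.

Lemma push_tperm d1 d2 : push (tperm d1 d2) = tperm (e d1) (e d2).
Proof.
apply/esym/eq_push => [|d]; first by rewrite perm_on_tperm ?imset_f.
exact/esym/inj_tperm.
Qed.

Lemma push_inj : injective push.
Proof.
move=> s t st; apply/permP => d; apply: e_inj; by rewrite -!pushE st.
Qed.

Lemma push_onto (t : {perm U}) : perm_on (e @: [set: D]) t -> exists s, t = push s.
Proof.
move=> tD; have ex d : exists d', e d' == t (e d).
  have : t (e d) \in e @: [set: D] by rewrite perm_closed // imset_f.
  by case/imsetP => d' _ ->; exists d'.
pose f d := xchoose (ex d); have fE d : e (f d) = t (e d) by apply/eqP/(xchooseP (ex d)).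
have f_inj : injective f.
  by move=> d1 d2 f12; apply/e_inj/(@perm_inj _ t); rewrite -!fE f12.
by exists (perm f_inj); apply: eq_push => // d; rewrite permE fE.
Qed.

Lemma push_iter s d i : (push s ^+ i)%g (e d) = e ((s ^+ i)%g d).
Proof. by elim: i => [|i IHi]; rewrite ?expg0 ?perm1 // !expgSr !permM IHi pushE. Qed.

Lemma porbit_push s d : porbit (push s) (e d) = e @: porbit s d.
Proof.
apply/setP => u; apply/porbitP/imsetP => [[i ->]|[_ /porbitP[i ->] ->]].
  by exists ((s ^+ i)%g d); rewrite ?mem_porbit ?push_iter.
by exists i; rewrite push_iter.
Qed.

(** The points outside the image of [e] are fixed: each adds one to the cardinal and one to the
    number of cycles. *)
Lemma plen_push s : plen (push s) = plen s.
Proof.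
elim/perm_fix_ind: s => [|s y z sz yz IHs]; first by rewrite push1 !plen1.
rewrite pushM push_tperm !plen_fix ?pushE ?sz ?IHs //.
by rewrite (inj_eq e_inj).
Qed.

Lemma stable_push s (A : {set U}) : stable (push s) A -> stable s [set d | e d \in A].
Proof. by move=> sA; apply/stableP => d; rewrite !inE -pushE stableE. Qed.

End Push.

Lemma transitive_generates (D : finType) (a s : {perm D}) r :
  [transitive <<[set a; s]>>%g, on [set: D] | 'P] = generates a s [set r].
Proof.
set G := <<_>>%g; have aG : a \in G by rewrite mem_gen // !inE eqxx.
have sG : s \in G by rewrite mem_gen // !inE eqxx orbT.
apply/idP/generatesP => [tr A rA aA sA z | gen].
  have [y /= _ e] := imsetP tr; have : r \in [set: D] by rewrite in_setT.
  rewrite e => /orbit_eqP er.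
  have : z \in orbit 'P G r by rewrite er -e in_setT.
  have GN : G \subset 'N(A | 'P)%g.
    rewrite gen_subG; apply/subsetP => t; rewrite !inE /= => /orP[]/eqP->;
    by apply/subsetP => w wA; rewrite inE /= apermE stableE.
  case/orbitP => g /(subsetP GN) gN <-.
  by rewrite (astabs_act _ gN); move: rA; rewrite sub1set.
apply/imsetP; exists r; rewrite ?in_setT //=; apply/esym/setP => z; rewrite in_setT.
have st t : t \in G -> stable t (orbit 'P G r).
  move=> tG; apply/stableP => w /orbitP[g gG <-]; apply/orbitP.
  by exists (g * t)%g; rewrite ?groupM //= actM.
by apply: gen => //; rewrite ?sub1set ?orbit_refl ?st.
Qed.

Lemma card_porbits_involution (D : finType) (a : {perm D}) :
  (forall d, a d != d) -> (forall d, a (a d) = d) -> #|D| = 2 * #|porbits a|.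
Proof.
move=> a1 a2; have c2 d : porbit a d = [set d; a d].
  apply/eqP; rewrite eqEsubset; apply/andP; split.
    apply: porbit_sub; last by rewrite !inE eqxx.
    by apply/stableP => z; rewrite !inE => /orP[]/eqP->; rewrite ?a2 eqxx ?orbT.
  by rewrite subUset !sub1set porbit_id -eq_porbit_mem porbit_perm1 eqxx.
rewrite -[LHS]sum1_card (partition_big (porbit a) (mem (porbits a))) /=; last first.
  by move=> d _; apply: imset_f.
rewrite mulnC -sum_nat_const.
apply: eq_bigr => _ /imsetP[d _ ->].
rewrite (eq_bigl (mem (porbit a d))) => [|z]; last by rewrite eq_porbit_mem.
by rewrite sum1_card c2 cards2 eq_sym a1.
Qed.

Section Plant.
Variables (D U : finType) (e : D -> U) (x : U).
Hypotheses (e_inj : injective e) (xN : x \notin e @: [set: D]).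
Implicit Type M : rooted_map D.
Let S := x |: e @: [set: D].
Local Notation push := (push e_inj).

Definition plant M : rooted_map U :=
  (push (alpha M), (push (sigma M) * tperm x (e (Defs.root M)))%g, x).

Lemma card_plant : #|S| = #|D|.+1.
Proof. by rewrite /S cardsU1 xN card_imset // cardsT. Qed.

Section PlantMap.
Variables (a s : {perm D}) (r : D).
Let phi : {perm D} := (a * s)%g.
Let s' : {perm U} := (push s * tperm x (e r))%g.
Let phi' : {perm U} := (push a * s')%g.

Let xe d : x != e d.
Proof. by apply: contraNneq xN => ->; rewrite imset_f. Qed.
Let phi'E : phi' = (push phi * tperm x (e r))%g.
Proof. by rewrite /phi' /s' pushM permA. Qed.
Let s'x : s' x = e r. Proof. by rewrite permM push_out // tpermL. Qed.
Let phi'x : phi' x = e r. Proof. by rewrite permM push_out // s'x. Qed.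
Let pushphiE : push phi = (phi' * tperm x (phi' x))%g.
Proof. by rewrite phi'x phi'E mulg_tpermK. Qed.
Let porb d : porbit phi' (e d) :\ x = e @: porbit phi d.
Proof. by rewrite -porbit_push pushphiE porbit_del // eq_sym. Qed.
Let porbx : porbit phi' x = x |: e @: porbit phi r.
Proof. by rewrite -porb -phi'x porbit_perm1 setD1K // porbit_id. Qed.
Let porbN d : d \notin porbit phi r -> porbit phi' (e d) = e @: porbit phi d.
Proof.
move=> dr; rewrite -porb; apply/setP => u; rewrite !inE.
have [->|//] := eqVneq u x; rewrite porbit_sym porbx !inE eq_sym (negbTE (xe d)) /=.
by rewrite mem_imset // (negbTE dr).
Qed.
Let mem_porbx d : (e d \in porbit phi' x) = (d \in porbit phi r).
Proof. by rewrite porbx !inE eq_sym (negbTE (xe d)) mem_imset. Qed.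

Lemma plant_generates :
  generates (push a) s' (x |: ~: S) = generates a s [set r].
Proof.
have sE : push s = (s' * tperm x (e r))%g by rewrite mulg_tpermK.
apply/generatesP/generatesP => gen A.
  rewrite sub1set => rA aA sA d; pose B := (x |: ~: S) :|: e @: A.
  have stB t : stable t A -> stable (push t) B.
    move=> tA; apply/stableP => u; rewrite ![_ \in B]inE => /orP[uS|/imsetP[w wA ->]].
      rewrite push_out ?uS //; move: uS; rewrite !inE.
      by case/orP => [/eqP->//|]; rewrite negb_or => /andP[].
    by rewrite pushE imset_f ?orbT // stableE.
  have : e d \in B.
    apply: gen; [exact: subsetUl|exact: stB|].
    rewrite /s' stableM ?stB // stable_tperm //; first by rewrite !inE eqxx.
    by rewrite in_setU imset_f ?orbT.
  rewrite in_setU in_setU1 in_setC eq_sym (negbTE (xe d)) in_setU1 orbC.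
  by rewrite [X in X || _]mem_imset // imset_f ?orbT ?orbF.
rewrite subUset sub1set => /andP[xA SA] aA s'A u.
have eA : e r \in A by rewrite -s'x stableE.
have sA : stable (push s) A by rewrite sE stableM // stable_tperm.
have [uS|] := boolP (u \in S); last by move=> uS; apply: (subsetP SA); rewrite inE.
move: uS; rewrite /S in_setU1 => /orP[/eqP->//|/imsetP[d _ ->]].
have := gen [set d | e d \in A]; rewrite sub1set inE => /(_ eA) g.
have := g (stable_push aA) (stable_push sA) d; by rewrite inE.
Qed.

Lemma plant_planted p :
  is_planted S p (push a) s' x <-> triangulation_with_boundary p (a, s, r).
Proof.
rewrite /triangulation_with_boundary /planar_map /alpha /sigma /faces /external_face.
rewrite /edges /vertices /faces /Defs.phi /alpha /sigma /Defs.root /=.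
rewrite (transitive_generates _ _ r) -plant_generates -/phi.
have Sx : x \in S by rewrite !inE eqxx.
have Se d : e d \in S by rewrite !inE imset_f ?orbT.
have DS : e @: [set: D] \subset S by apply: subsetUr.
have lens : plen s' = (plen s).+1 by rewrite /s' plen_ins ?push_out ?plen_push // eq_sym.
have lenphi : plen phi' = (plen phi).+1.
  by rewrite phi'E plen_ins ?push_out ?plen_push // eq_sym.
have ext : #|porbit phi' x| = #|porbit phi r|.+1.
  rewrite porbx cardsU1 card_imset // (_ : x \notin _) //.
  by apply: contra xN => /imsetP[d _ ->]; rewrite imset_f.
(* With E edges, V vertices and F faces the length condition reads
   [E + (2E - V + 1) + (2E - F + 1) = 4E]; the two units come from inserting [x] at its vertex and
   in its face. *)
have euler : #|D| = 2 * #|porbits a| ->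
   (plen (push a) + plen s' + plen phi' == 2 * #|S|.-1) =
   (#|porbits s| + #|porbits phi| == #|porbits a| + 2).
  move=> E; rewrite plen_push lens lenphi card_plant /plen E.
  have := card_porbits_le s; have := card_porbits_le phi; have := card_porbits_le a.
  rewrite E; clear; move=> ? ? ?; apply/eqP/eqP; lia.
split=> [P|].
  have a1 d : a d != d.
    by have := pl_afix P (Se d); rewrite pushE (inj_eq e_inj) eq_sym xe; apply.
  have a2 d : a (a d) = d by apply: e_inj; have := pl_inv P (e d); rewrite !pushE.
  apply/and3P; split.
  - apply/and4P; split; [exact/forallP|by apply/forallP => d; rewrite a2| exact: pl_gen P|].
    rewrite -euler; last exact: card_porbits_involution.
    by apply/eqP; apply: pl_len P.
  - by rewrite -eqSS -ext (pl_ext P).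
  apply/forall_inP => _ /imsetP[d _ ->]; apply/implyP; rewrite eq_porbit_mem => dr.
  rewrite -(card_imset _ e_inj) -porbN //; apply/eqP/(pl_tri P) => //.
  by rewrite -/phi' mem_porbx.
case/and3P => /and4P[/forallP a1 /forallP a2' gen eul] /eqP ep /forall_inP tri.
have a2 d : a (a d) = d by apply/eqP.
split => //.
- exact: perm_onS DS (push_on _ _).
- by rewrite perm_onM ?perm_on_tperm // (perm_onS DS) ?push_on.
- exact: push_out.
- move=> u; rewrite in_setU1 => /orP[/eqP->|/imsetP[d _ ->] _]; first by rewrite eqxx.
  by rewrite pushE (inj_eq e_inj).
- move=> u; have [/imsetP[d _ ->]|uN] := boolP (u \in e @: [set: D]).
    by rewrite !pushE a2.
  by rewrite !push_out.
- by apply/eqP; rewrite -/phi' euler //; apply: card_porbits_involution.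
- by rewrite -/phi' ext ep.
move=> u; rewrite in_setU1 => /orP[/eqP->|/imsetP[d _ ->] ur]; first by rewrite porbit_id.
rewrite -/phi' mem_porbx in ur *; rewrite porbN // card_imset //.
have dphi : porbit phi d \in porbits phi by apply: imset_f.
have /implyP := tri _ dphi.
by rewrite eq_porbit_mem => /(_ ur)/eqP.
Qed.
End PlantMap.

Lemma plant_inj : injective plant.
Proof.
move=> [[a s] r] [[a1 s1] r1] [/push_inj ea es].
have er : e r = e r1.
  have /= := congr1 (fun t : {perm U} => t x) es.
  by rewrite !permM !push_out // !tpermL.
move: es; rewrite /= er => /mulIg/push_inj es.
by congr (_, _, _); [exact: ea|exact: es|exact: e_inj].
Qed.

Lemma card_planted_root p : 0 < #|D| ->
  #|[set N in planted_set S p | Defs.root N == x]| =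
  #|[set M : rooted_map D | triangulation_with_boundary p M]|.
Proof.
move=> D0; rewrite -(card_imset _ plant_inj); apply: eq_card => -[[a s] y].
rewrite !inE; apply/andP/imsetP => [[/plantedP P /eqP/= yx]|[[[a1 s1] r]]].
  rewrite {}yx in P *.
  have S1 : S != [set x].
    by apply/eqP => e1; have := card_plant; rewrite e1 cards1 => -[e0]; rewrite -e0 in D0.
  have on t : perm_on S t -> t x = x -> perm_on (e @: [set: D]) t.
    move=> St tx; apply/subsetP => u; rewrite inE => tu; move/subsetP/(_ u tu): St.
    by rewrite in_setU1 => /orP[/eqP ux|//]; rewrite ux tx eqxx in tu.
  have [a1 aE] := push_onto e_inj (on _ (pl_ona P) (pl_ax P)).
  have /imsetP[r _ rE] : s x \in e @: [set: D].
    have : s x \in S by rewrite (perm_closed _ (pl_ons P)) !inE eqxx.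
    by rewrite in_setU1 (negbTE (planted_sx P S1)).
  have [s1 sE] := push_onto e_inj (on _ (cut_s'on P) (cut_s'x _ _)).
  have ME : (a, s, x) = plant (a1, s1, r).
    by rewrite /plant /alpha /sigma /= -aE -sE -rE mulg_tpermK.
  exists (a1, s1, r) => //; rewrite inE; apply/plant_planted.
  by move: P; case: ME => -> ->.
by rewrite inE => /plant_planted P -> /=; split; [apply/plantedP|].
Qed.

End Plant.

Section Relabel.
Variable D : finType.
Implicit Types (g h : {perm D}) (M N : rooted_map D).

Definition relabel g M : rooted_map D :=
  ((alpha M ^ g)%g, (sigma M ^ g)%g, g (Defs.root M)).

Definition tri_set p : {set rooted_map D} :=
  [set M | triangulation_with_boundary p M].

Lemma map_isoP M N : reflect (exists g, N = relabel g M) (map_iso M N).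
Proof.
apply: (iffP existsP) => -[g].
  case/and3P => /forallP ga /forallP gs /eqP gr; exists g.
  case: N ga gs gr => [[a s] r]; rewrite /alpha /sigma /Defs.root /= => ga gs <-.
  by congr (_, _, _); apply/permP => d; rewrite -(permKV g d) permJ;
    apply/esym/eqP; [apply: ga | apply: gs].
move=> ->; exists g; rewrite /relabel /alpha /sigma /Defs.root /= eqxx andbT.
by apply/andP; split; apply/forallP => d; rewrite permJ.
Qed.

(* Planting [relabel g M] along [Some] is planting [M] along [Some \o g]. *)
Lemma relabel_tri p g M : (relabel g M \in tri_set p) = (M \in tri_set p).
Proof.
have e_inj : injective (@Some D) by move=> d1 d2 [].
pose e' d := Some (g d).
have e'_inj : injective e' by move=> d1 d2 [] /perm_inj.
have SE (e : D -> option D) : injective e -> None \notin e @: [set: D] ->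
    None |: e @: [set: D] = [set: option D].
  move=> ei eN; apply/eqP; rewrite eqEcard subsetT /= cardsT card_option.
  by rewrite cardsU1 eN card_imset // cardsT.
have eN (e : D -> option D) : (forall d, e d != None) -> None \notin e @: [set: D].
  by move=> ne; apply/imsetP => -[d _ dN]; have := ne d; rewrite -dN.
have eN1 : None \notin Some @: [set: D] by apply: eN.
have eN2 : None \notin e' @: [set: D] by apply: eN.
have pE (t : {perm D}) : push e'_inj t = push e_inj (t ^ g)%g.
  apply/permP => -[d|]; last by rewrite !push_out.
  rewrite pushE -(permKV g d) permJ.
  exact: (pushE e'_inj t (g^-1%g d)).
case: M => [[a s] r]; rewrite !inE /relabel /alpha /sigma /Defs.root /=.
have H1 := plant_planted e_inj eN1 (a ^ g)%g (s ^ g)%g (g r) p.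
have H2 := plant_planted e'_inj eN2 a s r p.
rewrite !SE // in H1 H2; rewrite !pE in H2.
by apply/idP/idP => [/H1/H2 //|/H2/H1].
Qed.

(** Rooted maps are rigid: the set on which two relabellings agree contains the root and is stable
    under both permutations, so by transitivity it is everything. *)
Lemma relabel_inj p M : M \in tri_set p -> injective (relabel^~ M).
Proof.
rewrite inE => /and3P[/and4P[_ _ tr _] _ _] g h [ea es er].
move: tr; rewrite (transitive_generates _ _ (Defs.root M)) => /generatesP gen.
have st (t : {perm D}) : (t ^ g = t ^ h)%g -> stable t [set d | g d == h d].
  by move=> tgh; apply/stableP => d; rewrite !inE -(permJ t g) tgh => /eqP->; rewrite permJ.
apply/permP => d; have := gen [set d | g d == h d]; rewrite sub1set inE er eqxx.
by move=> /(_ isT (st _ ea) (st _ es) d); rewrite inE => /eqP.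
Qed.

(** By rigidity the symmetric group acts freely, so every isomorphism class has [#|D|!] members. *)
Lemma card_tri_set p : #|tri_set p| =
  #|D|`! * #|equivalence_partition (@map_iso D) (tri_set p)|.
Proof.
rewrite mulnC; apply: card_uniform_partition; last first.
  apply: equivalence_partitionP => M N P _ _ _; exact: map_iso_equiv.
move=> _ /imsetP[M MT ->].
have -> : [set N in tri_set p | map_iso M N] = relabel^~ M @: [set: {perm D}].
  apply/setP => N; rewrite inE; apply/andP/imsetP => [[_ /map_isoP[g ->]]|[g _ ->]].
    by exists g.
  by rewrite relabel_tri; split; last by apply/map_isoP; exists g.
rewrite card_imset; last exact: relabel_inj MT.
rewrite -(cardsT D) -card_perm cardsT; apply: eq_card => g.
by rewrite !inE; apply/esym/subsetP => z _; apply: in_setT.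
Qed.

End Relabel.

Lemma card_tri_set_darts m n p : m + 2 * p + 6 = 6 * n ->
  #|tri_set 'I_m p| = m`! * num_triangulations_darts m n p.
Proof.
move=> e; rewrite card_tri_set card_ord /num_triangulations_darts.
congr (_ * #|pred_of_set (equivalence_partition _ _)|); apply/setP => M; rewrite !inE.
case T: (triangulation_with_boundary p M) => //=.
by have /eqP := card_darts T; rewrite card_ord e eqn_pmul2l // eq_sym => ->.
Qed.

Lemma num_triangulationsE n p : 0 < p -> num_triangulations n p =
  if 2 * p + 6 <= 6 * n then num_triangulations_darts (6 * n - (2 * p + 6)) n p else 0.
Proof.
case: p => // p _; rewrite /num_triangulations /=; case: ifP => [le|nle].
  have lt : 6 * n - (2 * p.+1 + 6) < 6 * n by lia.
  rewrite (bigD1 (Ordinal lt)) //= big1 => [|i /eqP ne]; first exact: addn0.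
  apply: num_triangulations_darts_eq0; apply/eqP => e; apply: ne; apply/val_inj => /=; lia.
by rewrite big1 // => i _; apply: num_triangulations_darts_eq0; lia.
Qed.

(** Such a map would have [6 n - 2 p - 6 < 0] darts. The bound is also what makes every coefficient
    of the generating function in [x] a polynomial in [y]. *)
Lemma num_triangulations_eq0 n p : 3 * n < p + 3 -> num_triangulations n p = 0.
Proof.
case: p => [|p] lt; last by rewrite num_triangulationsE //; case: ifP => //; lia.
by rewrite /num_triangulations /=; case: eqP => //; lia.
Qed.

(** * The number of planted maps in terms of rooted triangulations *)

Section CardPlanted.
Variable U : finType.
Implicit Types (S : {set U}) (x : U).

Lemma is_planted1 x p : is_planted [set x] p 1 1 x <-> p = 0.
Proof.
have f1 y (t : {perm U}) : t = 1%g -> porbit t y = [set y].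
  by move=> ->; rewrite porbit_fix // perm1.
split=> [/pl_ext|->]; first by rewrite f1 ?mulg1 // cards1 => -[].
split; rewrite ?set11 ?perm_on1 ?perm1 ?mulg1 ?plen1 ?cards1 //.
- by move=> y /set1P->; rewrite eqxx.
- by move=> y; rewrite !perm1.
- by apply/generatesP => A; rewrite setUCr subTset => /eqP-> _ _ z; rewrite inE.
- by rewrite f1 ?mulg1 // cards1.
by move=> y /set1P->; rewrite porbit_id.
Qed.

Lemma card_planted1 x p : #|planted_set [set x] p| = (p == 0).
Proof.
have sub M : M \in planted_set [set x] p -> M = (1%g, 1%g, x).
  case: M => [[a s] y]; rewrite inE => /plantedP P.
  have /set1P-> := pl_root P.
  have on1 (t : {perm U}) : perm_on [set x] t -> t = 1%g.
    by move=> tx; apply: perm_on_id tx _; rewrite cards1.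
  by rewrite (on1 _ (pl_ona P)) (on1 _ (pl_ons P)).
have [p0|p0] := eqVneq p 0.
  apply/eqP/cards1P; exists (1%g, 1%g, x); apply/setP => M; rewrite inE.
  apply/idP/eqP => [/sub//|->]; rewrite inE; apply/plantedP.
  exact/is_planted1.
apply/eqP; rewrite cards_eq0; apply/eqP/setP => M; rewrite [RHS]inE.
apply/negP => MP; have e := sub _ MP; move: MP; rewrite e inE => /plantedP/is_planted1 p1.
by rewrite p1 eqxx in p0.
Qed.

Lemma card_planted_set_root S p x : x \in S -> S != [set x] ->
  #|[set M in planted_set S p | Defs.root M == x]| = #|tri_set 'I_#|S :\ x| p|.
Proof.
move=> xS S1; pose e := @enum_val _ (mem (S :\ x)).
have e_inj : injective e by apply: enum_val_inj.
have eE : e @: [set: 'I_#|S :\ x|] = S :\ x.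
  apply/setP => z; apply/imsetP/idP => [[i _ ->]|zS]; first exact: enum_valP.
  by exists (enum_rank_in zS z); rewrite // /e enum_rankK_in.
have xN : x \notin e @: [set: 'I_#|S :\ x|] by rewrite eE !inE eqxx.
rewrite -(card_planted_root e_inj xN) ?card_ord; last first.
  rewrite card_gt0; apply: contraNneq S1 => e0.
  by rewrite -(setD1K xS) e0 setU0.
by rewrite eE setD1K.
Qed.

Lemma card_planted_sum S p : #|planted_set S p| =
  \sum_(x in S) #|[set M in planted_set S p | Defs.root M == x]|.
Proof.
rewrite -sum1_card (partition_big (@Defs.root U) (mem S)) /=; last first.
  by move=> [[a s] x]; rewrite inE => /plantedP/pl_root.
apply: eq_bigr => x _; rewrite -sum1_card; apply: eq_bigl => M.
by rewrite [in RHS]inE.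
Qed.

(** There are [#|S|] choices for the half-edge and [(#|S| - 1)!] labellings of each rooted map on
    the other darts. The hypothesis is the relation of [card_darts] with the half-edge added, hence
    5 instead of 6. *)
Lemma card_planted S n p : #|S| + 2 * p + 5 = 6 * n ->
  #|planted_set S p| = #|S|`! * num_triangulations n p.
Proof.
move=> e; have [/eqP/cards1P[x Sx]|S1] := eqVneq #|S| 1.
  rewrite Sx cards1 mul1n card_planted1; rewrite Sx cards1 in e.
  case: p e => [|p] e; first by rewrite /num_triangulations /=; case: eqP => //; lia.
  (* A boundary of positive length would be counted with no dart at all, and then nothing can be the
     root. *)
  rewrite num_triangulationsE // (_ : 6 * n - _ = 0); last by lia.
  rewrite /num_triangulations_darts (_ : [set M | _] = set0) /=; last first.
    by apply/setP => -[q [k lt0]].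
  by rewrite /equivalence_partition imset0 cards0 if_same.
have nS x : S != [set x] by apply: contraNneq S1 => ->; rewrite cards1.
case: p e => [|p] e.
  rewrite planted_set_empty; last by move: S1 e; lia.
  by rewrite cards0 /num_triangulations /=; case: eqP => [|_]; rewrite ?muln0 //; lia.
have cS x : x \in S -> #|S :\ x| = #|S|.-1 by move=> xS; rewrite (cardsD1 x S) xS.
rewrite card_planted_sum (eq_bigr (fun=> #|S|.-1`! * num_triangulations n p.+1)).
  rewrite sum_nat_const mulnA; congr (_ * _).
  by case: #|S| e => [|k] //; lia.
move=> x xS; rewrite card_planted_set_root // (@card_tri_set_darts _ n); last first.
  by rewrite cS //; lia.
rewrite cS // num_triangulationsE //; case: ifP => [le|]; last by lia.
by congr (_ * num_triangulations_darts _ _ _); lia.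
Qed.

Lemma planted_set_mod S p : planted_set S p != set0 ->
  exists n, #|S| + 2 * p + 5 = 6 * n.
Proof.
case/set0Pn => -[[a s] x] PM; have /plantedP P : planted S p (a, s, x) by rewrite inE in PM.
have [Sx|nS] := eqVneq S [set x].
  have := card_planted1 x p; rewrite -Sx (cardsD1 (a, s, x)) PM; case: p PM P => // _ P _.
  by exists 1; rewrite Sx cards1.
have : 0 < #|[set M in planted_set S p | Defs.root M == x]|.
  by apply/card_gt0P; exists (a, s, x); rewrite inE PM /= eqxx.
rewrite card_planted_set_root ?(pl_root P) // => /card_gt0P[M]; rewrite inE => /card_darts.
rewrite card_ord => e; exists #|vertices M|.
by rewrite -e (cardsD1 x S) (pl_root P); lia.
Qed.

End CardPlanted.

(** * Tutte's equation *)

Lemma sum_subsets_card (U : finType) (A : {set U}) k v :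
  \sum_(C : {set U} | C \subset A) (#|C| == k) * v = 'C(#|A|, k) * v.
Proof.
rewrite -cards_draws -sum1dep_card big_distrl /= [RHS]big_mkcond [LHS]big_mkcond.
apply: eq_bigr => C _; rewrite mul1n.
by case: (C \subset A); case: (#|C| == k) => //=; rewrite ?mul1n ?mul0n.
Qed.

(** The hypothesis is the sum of the dart relations of the two pieces, with [m] and [n - m]
    vertices. The binomial number of sets [C] of the size imposed by [m] turns the product of the
    two factorials into [#|A|!]. *)
Lemma planted_pairs (U : finType) (A : {set U}) n i j :
  #|A| + 2 * (i + j) + 10 = 6 * n ->
  \sum_(C : {set U} | C \subset A) #|planted_set C i| * #|planted_set (A :\: C) j| =
  #|A|`! * \sum_(m < n.+1) num_triangulations m i * num_triangulations (n - m) j.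
Proof.
move=> e; rewrite big_distrr /=.
transitivity (\sum_(C : {set U} | C \subset A) \sum_(m < n.+1)
   (#|C| == 6 * m - (2 * i + 5)) * ((6 * m - (2 * i + 5))`! * num_triangulations m i *
    ((#|A| - (6 * m - (2 * i + 5)))`! * num_triangulations (n - m) j))).
  apply: eq_bigr => C CA.
  have cD : #|A :\: C| = #|A| - #|C| by rewrite cardsD (setIidPr CA).
  have cle : #|C| <= #|A| by apply: subset_leq_card.
  have term (m : 'I_n.+1) : #|C| + 2 * i + 5 = 6 * m ->
      (#|C| == 6 * m - (2 * i + 5)) * ((6 * m - (2 * i + 5))`! * num_triangulations m i *
      ((#|A| - (6 * m - (2 * i + 5)))`! * num_triangulations (n - m) j)) =
      #|planted_set C i| * #|planted_set (A :\: C) j|.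
    move=> em; rewrite (_ : 6 * m - (2 * i + 5) = #|C|); last by lia.
    rewrite eqxx mul1n -(card_planted em) -cD; congr (_ * _).
    by apply/esym/card_planted; rewrite cD; move: (ltn_ord m); lia.
  (* If the size matches although the relation fails, the subtraction was truncated; then
     [6 * m < 2 * i + 5], and no map is counted. *)
  have zero (m : 'I_n.+1) : #|C| + 2 * i + 5 != 6 * m ->
      (#|C| == 6 * m - (2 * i + 5)) * ((6 * m - (2 * i + 5))`! * num_triangulations m i *
      ((#|A| - (6 * m - (2 * i + 5)))`! * num_triangulations (n - m) j)) = 0.
    move=> /eqP em; case: eqP => [c|_]; last by rewrite mul0n.
    by rewrite num_triangulations_eq0 ?muln0 ?mul0n //; lia.
  have [C0|/planted_set_mod[m em]] := eqVneq (planted_set C i) set0.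
    rewrite C0 cards0 mul0n big1 // => m _.
    have [em|] := eqVneq (#|C| + 2 * i + 5) (6 * m); last exact: zero.
    by rewrite (term m em) C0 cards0.
  have mn : m < n.+1 by lia.
  rewrite (bigD1 (Ordinal mn)) //= (term (Ordinal mn) em) big1; first exact/esym/addn0.
  move=> m' nm; apply: zero; apply: contra nm => /eqP em'; apply/eqP/val_inj => /=; lia.
rewrite exchange_big /=; apply: eq_bigr => m _; rewrite sum_subsets_card.
have mn := ltn_ord m.
have [lt|le] := ltnP (3 * m) (i + 3).
  by rewrite (num_triangulations_eq0 lt) !(mul0n, muln0).
have [lt|le'] := ltnP (3 * (n - m)) (j + 3).
  by rewrite (num_triangulations_eq0 lt) !(mul0n, muln0).
have kA : 6 * m - (2 * i + 5) <= #|A| by lia.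
by rewrite -(bin_fact kA) mulnACA !mulnA.
Qed.

Lemma num_triangulations_tutte n p : 0 < p -> num_triangulations n p =
  num_triangulations n p.+1 + \sum_(i < p.-1) \sum_(m < n.+1)
    num_triangulations m i * num_triangulations (n - m) (p.-2 - i).
Proof.
(* At [3 n = p + 3] no dart is left and below it their number is negative, so all terms vanish for
   [3 n < p + 4]; in each product one factor falls under [num_triangulations_eq0]. Otherwise at
   least three darts, half-edge included, are available for the labelled recursion. *)
move=> p0; have [lt|le] := ltnP (3 * n) (p + 4).
  have zero : \sum_(i < p.-1) \sum_(m < n.+1)
    num_triangulations m i * num_triangulations (n - m) (p.-2 - i) = 0.
    rewrite big1 // => i _; rewrite big1 // => m _.
    have [l|l] := ltnP (3 * m) (i + 3); first by rewrite num_triangulations_eq0.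
    rewrite [X in _ * X]num_triangulations_eq0 ?muln0 //.
    by have := ltn_ord m; have := ltn_ord i; lia.
  rewrite zero [X in _ = X + _]num_triangulations_eq0; last by lia.
  have [l|l] := ltnP (3 * n) (p + 3); first by rewrite num_triangulations_eq0.
  rewrite num_triangulationsE //; case: ifP => // _.
  rewrite (_ : 6 * n - _ = 0); last by lia.
  rewrite /num_triangulations_darts (_ : [set M | _] = set0) /=; last first.
    by apply/setP => -[q [k lt0]].
  by rewrite /equivalence_partition imset0 cards0.
pose K := 6 * n - 2 * p - 5; pose S := [set: 'I_K].
have cS : #|S| = K by rewrite cardsT card_ord.
have eK : #|S| + 2 * p + 5 = 6 * n by rewrite cS /K; lia.
have K1 : 1 < #|S| by lia.
have := card_planted_rec K1 p0; rewrite (card_planted eK).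
have cx x : #|S :\ x| = K.-1 by have /(congr1 predn) := cardsD1 x S; rewrite in_setT cS => /esym.
rewrite (eq_bigr (fun=> K.-1 * (K.-2`! * num_triangulations n p.+1))); last first.
  move=> x _; rewrite (eq_bigr (fun=> K.-2`! * num_triangulations n p.+1)).
    by rewrite sum_nat_const cx.
  move=> y yS; have cy : #|S :\ x :\ y| = K.-2 by rewrite -(cx x) (cardsD1 y (S :\ x)) yS.
  by rewrite (card_planted (n := n)) cy //; lia.
rewrite [X in _ + X](eq_bigr (fun=> K.-1`! * \sum_(i < p.-1) \sum_(m < n.+1)
    num_triangulations m i * num_triangulations (n - m) (p.-2 - i))); last first.
  move=> x _; rewrite exchange_big /= big_distrr /=; apply: eq_bigr => i _.
  by rewrite (@planted_pairs _ _ n) ?cx //; have := ltn_ord i; lia.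
rewrite !sum_nat_const cS !mulnA.
(* Opening a triangle uses up the labels of [x] and [r'], cutting a bridge only that of [x]; either
   way the common factor is [K!]. *)
have -> : K * K.-1 * K.-2`! = K`! by move: K1; rewrite cS; case: (K) => [|[|k]] // _; rewrite !factS !mulnA.
have -> : K * K.-1`! = K`! by move: K1; rewrite cS; case: (K) => [|k].
by rewrite -mulnDr => /eqP; rewrite eqn_pmul2l ?fact_gt0 // => /eqP.
Qed.

(** * Power series *)

Import GRing.Theory.
Local Open Scope ring_scope.

Section FpsTheory.
Variable R : comNzRingType.
Implicit Types (f g : fps R) (c : R).

Lemma coef_fps_sum (I : Type) (r : seq I) (P : pred I) (F : I -> fps R) n :
  (\sum_(i <- r | P i) F i) n = \sum_(i <- r | P i) F i n.
Proof. exact: (big_morph (fun f : fps R => f n) (fun f g => coef_fpsD f g n) (coef_fps0 R n)). Qed.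

Lemma coef_fps_constM c f n : (fps_const c * f) n = c * f n.
Proof.
by rewrite coef_fpsM big_ord_recl /= subn0 big1 ?addr0 // => i _; rewrite mul0r.
Qed.

Lemma coef_fps_XM f n : (fps_X * f) n = if n is m.+1 then f m else 0.
Proof.
rewrite coef_fpsM big_ord_recl /= mul0r add0r; case: n => [|n]; first by rewrite big_ord0.
by rewrite big_ord_recl /= mul1r subn1 big1 ?addr0 // => i _; rewrite mul0r.
Qed.

Lemma coef_fps_XMS f n : (fps_X * f) n.+1 = f n.
Proof. exact: coef_fps_XM. Qed.

Lemma fps_constD c d : fps_const (c + d) = fps_const c + fps_const d.
Proof. by apply: fpsP => -[|n] /=; rewrite ?addr0. Qed.

Lemma fps_constN c : fps_const (- c) = - fps_const c.
Proof. by apply: fpsP => -[|n] /=; rewrite ?oppr0. Qed.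

Lemma fps_constM c d : fps_const (c * d) = fps_const c * fps_const d.
Proof. by apply: fpsP => -[|n]; rewrite coef_fps_constM /= ?mulr0. Qed.

Lemma fps_XM_inj : injective (fun f => fps_X * f).
Proof.
move=> f g fg; apply: fpsP => n.
by have := congr1 (fun h : fps R => h n.+1) fg; rewrite !coef_fps_XM.
Qed.

Lemma fps_thetaD f g : fps_theta (f + g) = fps_theta f + fps_theta g.
Proof. by apply: fpsP => n /=; rewrite mulrnDl. Qed.

Lemma fps_thetaN f : fps_theta (- f) = - fps_theta f.
Proof. by apply: fpsP => n /=; rewrite mulNrn. Qed.

Lemma fps_thetaM f g : fps_theta (f * g) = fps_theta f * g + f * fps_theta g.
Proof.
apply: fpsP => n; rewrite coef_fpsD !coef_fpsM /= -sumrMnl -big_split /=.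
apply: eq_bigr => i _; rewrite mulrnAl mulrnAr -mulrnDr subnKC //.
by rewrite -ltnS.
Qed.

Lemma fps_theta_const c : fps_theta (fps_const c) = 0.
Proof. by apply: fpsP => -[|n] /=; rewrite ?mulr0n ?mul0rn. Qed.

Lemma fps_theta_X : fps_theta fps_X = fps_X :> fps R.
Proof. by apply: fpsP => -[|[|n]] //=; rewrite mul0rn. Qed.

Lemma fps_X_divX_theta f : fps_X * fps_divX (fps_theta f) = fps_theta f.
Proof. by apply: fps_divXK; rewrite /= mulr0n. Qed.

End FpsTheory.

(** * Series in [y] over series in [x]: the Euler operator in [x], and polynomiality in [y] *)

Section Theta2.
Variable R : comNzRingType.
Implicit Types (F G : fps (fps R)).
Local Notation D := (fps_map (@fps_theta R)).

Lemma map_thetaD F G : D (F + G) = D F + D G.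
Proof. by apply: fpsP => p; apply: fps_thetaD. Qed.

Lemma map_thetaN F : D (- F) = - D F.
Proof. by apply: fpsP => p; apply: fps_thetaN. Qed.

Lemma map_thetaM F G : D (F * G) = D F * G + F * D G.
Proof.
apply: fpsP => p; rewrite coef_fpsD !coef_fpsM /=.
have theta0 : fps_theta 0 = 0 :> fps R by apply: fpsP => n /=; rewrite mul0rn.
rewrite (big_morph _ (@fps_thetaD R) theta0).
by rewrite -big_split; apply: eq_bigr => i _; apply: fps_thetaM.
Qed.

Lemma map_theta_X : D fps_X = 0.
Proof.
apply: fpsP => p /=; apply: fpsP => n /=; case: (p == 1%N); rewrite ?mul0rn //.
by case: n => [|n] /=; rewrite ?mulr0n ?mul0rn.
Qed.

Lemma map_theta_const f : D (fps_const f) = fps_const (fps_theta f).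
Proof. by apply: fpsP => -[|p] //=; apply: fpsP => n /=; rewrite mul0rn. Qed.

Lemma map_divXK F : fps_const fps_X * fps_map (@fps_divX R) (D F) = D F.
Proof. by apply: fpsP => p; rewrite coef_fps_constM /= fps_X_divX_theta. Qed.

(** The coefficient of each power of [x] is a polynomial in [y]; one degree bound serves all powers
    up to [n], since a product mixes them. *)
Definition y_polynomial F := forall n, exists P, forall p j,
  (P <= p)%N -> (j <= n)%N -> F p j = 0.

Lemma y_polynomialD F G : y_polynomial F -> y_polynomial G -> y_polynomial (F + G).
Proof.
move=> Fp Gp n; have [P FP] := Fp n; have [Q GQ] := Gp n; exists (maxn P Q) => p j.
by rewrite geq_max => /andP[Pp Qp] jn; rewrite !coef_fpsD FP ?GQ ?addr0.
Qed.

Lemma y_polynomialN F : y_polynomial F -> y_polynomial (- F).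
Proof.
by move=> Fp n; have [P FP] := Fp n; exists P => p j Pp jn; rewrite !coef_fpsN FP ?oppr0.
Qed.

Lemma y_polynomialM F G : y_polynomial F -> y_polynomial G -> y_polynomial (F * G).
Proof.
move=> Fp Gp n; have [P FP] := Fp n; have [Q GQ] := Gp n; exists (P + Q)%N => p j PQp jn.
rewrite coef_fpsM coef_fps_sum big1 // => i _; rewrite coef_fpsM big1 // => k _.
have kj : (k <= j)%N by rewrite -ltnS.
have [Pi|iP] := leqP P i; first by rewrite FP ?mul0r // (leq_trans kj).
rewrite [X in _ * X]GQ ?mulr0 //; first by move: iP PQp; clear; lia.
exact: leq_trans (leq_subr _ _) jn.
Qed.

Lemma y_polynomial_const f : y_polynomial (fps_const f).
Proof. by move=> n; exists 1%N => -[|p] j. Qed.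

Lemma y_polynomial_X : y_polynomial fps_X.
Proof. by move=> n; exists 2%N => -[|[|p]] j. Qed.

Lemma y_polynomial_nat k : y_polynomial k%:R.
Proof.
elim: k => [|k IHk]; first by move=> n; exists 0%N.
rewrite -addn1 natrD; apply: y_polynomialD => //; apply: (y_polynomial_const 1).
Qed.

Lemma y_polynomial_theta F : y_polynomial F -> y_polynomial (fps_theta F).
Proof.
move=> Fp n; have [P FP] := Fp n; exists P => p j Pp jn /=.
have mulrnE (f : fps R) m : (f *+ m) j = f j *+ m.
  by elim: m => [|m IHm]; rewrite ?mulr0n // !mulrS coef_fpsD IHm.
by rewrite mulrnE FP // mul0rn.
Qed.

Lemma y_polynomial_divX_theta F :
  y_polynomial F -> y_polynomial (fps_map (@fps_divX R) (D F)).
Proof.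
move=> Fp n; have [P FP] := Fp n.+1; exists P => p j Pp jn /=.
by rewrite FP // mul0rn.
Qed.

(* To lowest order in [x] the first factor is [1 - y]; the lowest nonzero
   coefficient [c] of [k] would thus give [c * y^2 / (1 - y)], which is not a
   polynomial, as a coefficient of [G]. *)
Lemma y_polynomial_const_eq0 (H G : fps (fps R)) (k : fps R) :
  (forall p, H p 0%N = 0) -> y_polynomial G ->
  (1 - fps_X + H) * G = fps_X * (fps_X * fps_const k) -> k = 0.
Proof.
move=> H0 Gp eG; suff all n : (forall p, G p n = 0) /\ k n = 0.
  by apply: fpsP => n; have [_ ->] := all n.
elim/ltn_ind: n => n IHn.
(* [H] is divisible by [x], so only coefficients of [G] of lower order in [x] occur, and these are
   zero by induction. *)
have HG p : (H * G) p n = 0.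
  rewrite coef_fpsM coef_fps_sum big1 // => i _; rewrite coef_fpsM big1 // => -[[|j] jn] _ /=.
    by rewrite H0 mul0r.
  by have [-> _] := IHn (n - j.+1)%N ltac:(lia); rewrite mulr0.
have step p : G p n - (if p is q.+1 then G q n else 0) = (p == 2%N)%:R * k n.
  have : ((1 - fps_X + H) * G) p n = (fps_X * (fps_X * fps_const k)) p n by rewrite eG.
  rewrite mulrDl mulrBl mul1r !coef_fpsD !coef_fpsN HG addr0 !coef_fps_XM.
  case: p => [|[|[|p]]]; rewrite ?coef_fps_XM /= ?mul1r ?mul0r //.
have G0 : G 0%N n = 0 by have := step 0%N; rewrite mul0r subr0.
have G1 : G 1%N n = 0 by have := step 1%N; rewrite mul0r G0 subr0.
(* Multiplication by [1 - y] takes differences of consecutive coefficients, so those of [G] are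
   constant from [y^2] on; polynomiality makes the constant zero. *)
have Gk p : G p.+2 n = k n.
  elim: p => [|p IHp]; first by have := step 2%N; rewrite G1 subr0 mul1r.
  by have /eqP := step p.+3; rewrite mul0r IHp subr_eq0 => /eqP.
have k0 : k n = 0.
  by have [P GP] := Gp n; rewrite -(Gk P) GP // ltnW.
by split=> // -[|[|p]] //; rewrite Gk.
Qed.

End Theta2.

(** * The elimination, as identities in a commutative ring *)

Section TutteAlgebra.
Variable R : comNzRingType.
Implicit Types (x y T W t w c : R).

(** The multiplier [k] is the certificate; [ring] then checks the difference identity. *)
Lemma eq_lincomb (a b c d k : R) : a - b = k * (c - d) -> c = d -> a = b.
Proof. by move=> e cd; apply/eqP; rewrite -subr_eq0 e cd subrr mulr0. Qed.

(** The hypothesis is [x d/dx] of Tutte's equation, where [x * W] and [x * w] are the derivatives of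
    [T] and [t]. Written in this way, a factor [x] can be cancelled. *)
Lemma tutte_algebra_x x y T W w :
  y * (x * W) = x * y + y * (y * (y * (x * W * T + T * (x * W)))) + x * W - x
    - y * (x * w) ->
  x * ((1 - y + 2 * (y * (y * (y * T)))) * W) = x * (1 - y + y * w).
Proof. by move=> e; apply: (@eq_lincomb _ _ _ _ (-1) _ e); ring. Qed.

(** The first two equations are multiplied by the coefficients with which [W] and [Ty] enter on the
    left, up to the sign of [Ty], and so eliminate both. The terms in [T * T] then left over require
    the multiple [6 - 2 * y] of Tutte's equation, and this also removes the terms linear in [T]. *)
Lemma tutte_algebra_G x y T Ty W t w :
  (1 - y + 2 * (y * (y * (y * T)))) * W = 1 - y + y * w ->
  y * T + y * Ty = x * y + (y * (y * (y * (T * T))) + y * (y * (y * (T * T)) +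
    y * (y * (T * T) + y * (Ty * T + T * Ty)))) + Ty - y * t ->
  y * T = x * y + y * (y * (y * (T * T))) + T - x - y * t ->
  (1 - y + 2 * (y * (y * (y * T)))) *
    (6 * (x * W) - 4 * (y * (x * W)) - 2 * (y * ((3 * (x * w) - 4 * t) * W))
     - (2 - 2 * y) * Ty - (6 - 4 * y) * T)
  = y * (y * (2 * (x * w - 2 * t - (3 * (x * w) - 4 * t) * w))).
Proof.
move=> eW ey e0; apply: (@eq_lincomb _ _ _ _ (6 - 2 * y) _ e0).
apply/eqP; rewrite -subr_eq0; apply/eqP.
transitivity ((2 - 2 * y) * (y * T + y * Ty - (x * y + (y * (y * (y * (T * T))) +
    y * (y * (y * (T * T)) + y * (y * (T * T) + y * (Ty * T + T * Ty)))) + Ty - y * t)) +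
  (6 * x - 4 * (y * x) - 2 * (y * (3 * (x * w) - 4 * t))) *
    ((1 - y + 2 * (y * (y * (y * T)))) * W - (1 - y + y * w))); first by ring.
by rewrite eW ey !subrr !mulr0 addr0.
Qed.

(** [2 * (u - t)] is the difference of [3 * u - 4 * t] and [u - 2 * t], and the hypothesis rewrites
    the latter. *)
Lemma tutte_algebra_quotient t u w :
  u - 2 * t - (3 * u - 4 * t) * w = 0 -> 2 * (u - t) = (3 * u - 4 * t) * (1 - w).
Proof. by move=> e; apply: (@eq_lincomb _ _ _ _ (-1) _ e); ring. Qed.

Lemma tutte_algebra_pde y T Tx Ty W c :
  6 * Tx - 4 * (y * Tx) - 2 * (y * (2 * c * W)) - (2 - 2 * y) * Ty
    - (6 - 4 * y) * T = 0 ->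
  6 * Tx - 2 * Ty - 6 * T + (y * T + y * Ty) =
    4 * y * W * c + y * (4 * Tx - 3 * T - Ty).
Proof. by move=> e; apply: (@eq_lincomb _ _ _ _ 1 _ e); ring. Qed.

End TutteAlgebra.

(** * From Tutte's equation to the differential equation *)

Section PartialDifferentialEquation.
Local Notation A := (fps (fps rat)).
Local Notation y := (fps_X : A).
Local Notation x := (fps_const fps_X : A).

Lemma triangulation_gf0 : triangulation_gf 0%N = fps_X.
Proof. by apply: fpsP => n /=; rewrite /num_triangulations. Qed.

Lemma coef_triangulation_gf_sqr k n : (triangulation_gf * triangulation_gf) k n =
  (\sum_(i < k.+1) \sum_(m < n.+1)
     num_triangulations m i * num_triangulations (n - m) (k - i))%N%:R.
Proof.
rewrite coef_fpsM coef_fps_sum natr_sum; apply: eq_bigr => i _.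
by rewrite coef_fpsM natr_sum; apply: eq_bigr => m _; rewrite natrM.
Qed.

(** At [y^0] the equation says that the boundary of length 0 contributes [x], at [y^1] the two
    occurrences of [t] cancel, and at [y^(k+2)] it is the recursion for boundary length [k + 1]. *)
Lemma tutte_equation :
  let T := triangulation_gf in
  y * T = x * y + y * (y * (y * (T * T))) + T - x - y * fps_const (T 1%N).
Proof.
move=> T; rewrite /T {T}; apply: fpsP => -[|[|k]]; rewrite !(coef_fpsD, coef_fpsN) coef_fps_constM.
- by rewrite !coef_fps_XM triangulation_gf0 /= mulr0; ring.
- by rewrite !coef_fps_XM triangulation_gf0 /=; ring.
rewrite !coef_fps_XMS [fps_X _](_ : _ = 0) // [fps_const _ _](_ : _ = 0) //.
rewrite mulr0 !subr0 add0r.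
case: k => [|k]; apply: fpsP => n; rewrite coef_fpsD.
  by rewrite coef_fps_XM /= num_triangulations_tutte //= big_ord0 addn0 add0r.
rewrite coef_fps_XMS coef_triangulation_gf_sqr /= num_triangulations_tutte //=.
by rewrite natrD addrC.
Qed.

Lemma y_polynomial_triangulation_gf : y_polynomial triangulation_gf.
Proof.
move=> n; exists (3 * n).+1 => p j lp jn /=; rewrite num_triangulations_eq0 //.
by lia.
Qed.

Lemma coef_triangulation_gf_0 p : triangulation_gf p 0%N = 0.
Proof. by rewrite /= num_triangulations_eq0 // muln0 addn3. Qed.

Section Identity.
Variable T : A.
Hypotheses (T_poly : y_polynomial T) (T_0 : forall p, T p 0%N = 0).
Hypothesis T_tutte :
  y * T = x * y + y * (y * (y * (T * T))) + T - x - y * fps_const (T 1%N).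

Let Td : A := fps_map (@fps_theta rat) T.
Let Ty : A := fps_theta T.
Let W : A := fps_map (@fps_divX rat) Td.
Let t : fps rat := T 1%N.
Let td : fps rat := fps_theta t.
Let w : fps rat := fps_divX td.
Local Notation "c %:C" := (fps_const c : A) (at level 2, format "c %:C").
Let H : A := 2 * (y * (y * (y * T))).
Let G : A := 6 * Td - 4 * (y * Td) - 2 * (y * ((3 * td%:C - 4 * t%:C) * W))
  - (2 - 2 * y) * Ty - (6 - 4 * y) * T.
Let K : fps rat := td - 2 * t - (3 * td - 4 * t) * w.

Let Wx : x * W = Td. Proof. exact: map_divXK. Qed.
Let wx : x * w%:C = td%:C. Proof. by rewrite -fps_constM fps_X_divX_theta. Qed.

Let const_nat k : (k%:R)%:C = k%:R :> A.
Proof.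
by elim: k => [|k IHk]; [apply: fpsP => -[|p] | rewrite !mulrS fps_constD IHk].
Qed.

Lemma tutte_denominator_W : (1 - y + H) * W = 1 - y + y * w%:C.
Proof.
have xI : injective (fun F : A => x * F).
  move=> F F' e; apply: fpsP => p; apply: fps_XM_inj; rewrite -!coef_fps_constM.
  by rewrite e.
apply: xI; apply: tutte_algebra_x; rewrite Wx wx.
have := congr1 (fps_map (@fps_theta rat)) T_tutte.
rewrite !(map_thetaD, map_thetaN, map_thetaM, map_theta_X, map_theta_const, fps_theta_X).
by rewrite !(mul0r, mulr0, add0r, addr0).
Qed.

Lemma tutte_denominator_G : (1 - y + H) * G = y * (y * (2 * K)%:C).
Proof.
rewrite /K !(const_nat, fps_constM, fps_constD, fps_constN) -wx /G -Wx -wx.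
apply: tutte_algebra_G T_tutte; first exact: tutte_denominator_W.
have := congr1 (@fps_theta (fps rat)) T_tutte.
rewrite !(fps_thetaD, fps_thetaN, fps_thetaM, fps_theta_X, fps_theta_const).
by rewrite !(mul0r, mulr0, add0r, addr0, subr0).
Qed.

Lemma triangulation_ode : K = 0.
Proof.
have H0 p : H p 0%N = 0.
  have c0 (F : A) : (forall q, F q 0%N = 0) -> forall q, (y * F) q 0%N = 0.
    by move=> F0 [|q]; rewrite coef_fps_XM ?F0.
  have n0 : forall q, (y * (y * (y * T))) q 0%N = 0 by do 3!apply: (c0).
  by rewrite /H mulr_natl mulr2n !coef_fpsD n0 addr0.
have Gp : y_polynomial G.
  have Wp : y_polynomial W by apply: y_polynomial_divX_theta.
  have Tdp : y_polynomial Td.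
    rewrite -Wx; apply: y_polynomialM Wp; exact: y_polynomial_const.
  have Typ : y_polynomial Ty by apply: y_polynomial_theta.
  have yp := @y_polynomial_X rat; have cp := @y_polynomial_const rat.
  have np := @y_polynomial_nat rat.
  have Bp (F F' : A) : y_polynomial F -> y_polynomial F' -> y_polynomial (F - F').
    by move=> FP FP'; apply/y_polynomialD/y_polynomialN.
  have Mp := @y_polynomialM rat.
  by rewrite /G; do !(exact: (np) || exact: (cp) || apply: (Bp) || apply: (Mp)).
have K2 := y_polynomial_const_eq0 H0 Gp tutte_denominator_G.
apply: fpsP => n; have := congr1 (fun f : fps rat => f n) K2.
by rewrite mulr_natl mulr2n coef_fpsD -mulr2n => /eqP; rewrite Num.Theory.mulrn_eq0 => /eqP.
Qed.

Lemma tutte_G_eq0 : G = 0.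
Proof.
(* As a series in [y] this factor has constant term 1, because [H] is divisible by [y^3]. *)
have U : 1 - y + H \is a GRing.unit.
  rewrite unit_fps coef_fpsD coef_fpsB coef_fps1 /H mulr_natl mulr2n coef_fpsD.
  rewrite !coef_fps_XM !addr0; exact: unitr1.
apply: (mulrI U); rewrite mulr0 tutte_denominator_G triangulation_ode mulr0.
by rewrite (_ : 0%:C = 0) ?mulr0 //; apply: fpsP => -[].
Qed.

Lemma tutte_pde : 1 - w \is a GRing.unit ->
  6 * Td - 2 * Ty - 6 * T + fps_theta (y * T) =
  4 * y * W * ((td - t) / (1 - w))%:C + y * (4 * Td - 3 * T - Ty).
Proof.
move=> wU; have c2 : 2 * ((td - t) / (1 - w)) = 3 * td - 4 * t.
  apply: (mulIr wU); rewrite -mulrA divrK //.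
  exact: tutte_algebra_quotient triangulation_ode.
have cC : 2 * ((td - t) / (1 - w))%:C = 3 * td%:C - 4 * t%:C.
  by rewrite -!const_nat -!fps_constM c2 fps_constD fps_constN.
rewrite fps_thetaM fps_theta_X; apply: tutte_algebra_pde; rewrite cC.
exact: tutte_G_eq0.
Qed.

End Identity.
End PartialDifferentialEquation.

Theorem mainTheorem4 :
  let y : fps (fps rat) := fps_X in
  let T : fps (fps rat) := triangulation_gf in
  let Tdot : fps (fps rat) := fps_map (@fps_theta rat) T in
  let ydy : fps (fps rat) -> fps (fps rat) := @fps_theta (fps rat) in
  let t : fps rat := T 1%N in
  let tdot : fps rat := fps_theta t in
  6 * Tdot - 2 * ydy T - 6 * T + ydy (y * T) =
  4 * y * fps_map (@fps_divX rat) Tdot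
    * fps_const ((tdot - t) / (1 - fps_divX tdot))
  + y * (4 * Tdot - 3 * T - ydy T).
Proof.
apply: (tutte_pde y_polynomial_triangulation_gf coef_triangulation_gf_0 tutte_equation).
exact: unit_triangulation_denominator.
Qed.
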